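(* Consider a discrete-time system $x^{i,+}=f^i(x,u)$, $i=1,\dots,n$, $\dim(u)=m$, with smooth $f^i$, $\mathrm{rank}(\partial_{(x,u)}f)=n$ and $\mathrm{rank}(\partial_u f)=m$, locally around an equilibrium, which is transformed by a state transformation $(\bar x_1,\bar x_2)=\Phi_x(x)$ into the form $$\bar x_2^+=f_2(\bar x_2,\bar x_1,u),\qquad \bar x_1^+=f_1(\bar x_2,\bar x_1,u)$$ such that $\Delta_1=\mathrm{span}\{\partial_{\bar x_1^+}\}$ (and $P_2=\mathrm{span}\{\mathrm{d}\bar x_2\}$). (a) Performing an input transformation $(\bar u_1,\bar u_2)=\Phi_u(x,u)$ (invertible w.r.t. $u$) with $\dim(\bar u_2)=\mathrm{rank}(\partial_u f_2)$ such that $\dim(\bar u_2)$ equations of the subsystem $\bar x_2^+=f_2(\bar x_2,\bar x_1,u)$ are simplified to $\bar x_2^{i_2,+}=\bar u_2^{i_2}$ (that is, $\bar u_2^{i_2}=f_2^{i_2}(\bar x_2,\bar x_1,u)$ for $\dim(\bar u_2)$ of the components of $f_2$, with $\bar u_1$ chosen such that the transformation is invertible w.r.t. $u$) results in $D_0=\mathrm{span}\{\partial_{\bar u_1}\}$. (b) Conversely, after an input transformation $(\bar u_1,\bar u_2)=\Phi_u(x,u)$ which results in $D_0=\mathrm{span}\{\partial_{\bar u_1}\}$, there exists a further input transformation of the form $\tilde u_2=\Phi_{u_2}(\bar x,\bar u_2)$ with $\dim(\tilde u_2)=\dim(\bar u_2)$ such that $\dim(\tilde u_2)$ equations of the subsystem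 for $\bar x_2^+$ take the form $\bar x_2^{i_2,+}=\tilde u_2^{i_2}$.
   Context: Setting. The map $f$ is regarded as a submersion $f:\mathcal{X}\times\mathcal{U}\to\mathcal{X}^+$ from a manifold with coordinates $(x,u)$ to a manifold with coordinates $x^+$. All statements are local, in a suitable (sufficiently small) neighborhood of an equilibrium $(x_0,u_0)$, i.e. $x_0=f(x_0,u_0)$. All distributions and codistributions that occur are assumed to be smooth and of locally constant dimension. A state transformation $(\bar x_1,\bar x_2)=\Phi_x(x)$ is a local diffeomorphism; it is applied both to $x$ and (as $(\bar x_1^+,\bar x_2^+)=\Phi_x(x^+)$) to $x^+$. An input transformation $(\bar u_1,\bar u_2)=\Phi_u(x,u)$ is locally invertible w.r.t. $u$; after it, $(\bar x_1,\bar x_2,\bar u_1,\bar u_2)$ are the coordinates on $\mathcal{X}\times\mathcal{U}$, and $\partial_{\bar u_1}$ is taken in these coordinates. Write $\bar x=(\bar x_1,\bar x_2)$. Adapted coordinates and projectability. Since $f$ is a submersion, one can choose functions $h^j$ such that $\theta^i=f^i(x,u)$, $i=1,\dots,n$, $\xi^j=h^j(x,u)$, $j=1,\dots,m$, are local coordinates on $\mathcal{X}\times\mathcal{U}$. A vector field on $\mathcal{X}\times\mathcal{U}$ is called projectable if in these coordinates it has the form $v=a^i(\theta)\partial_{\theta^i}+b^j(\theta,\xi)\partial_{\xi^j}$; then $f_*(v)=a^i(x^+)\partial_{x^{i,+}}$ is a well-defined vector field on $\mathcal{X}^+$. A distribution is called projectable if it admits a basis of projectable vector fields; its pushforward is spanned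 by the pushforwards of these. Definitions of $D_0$, $\Delta_1$, $P_2$. $D_0$ is the largest projectable subdistribution of $E_0=\mathrm{span}\{\partial_u\}$ on $\mathcal{X}\times\mathcal{U}$, and $\Delta_1=f_*(D_0)$ on $\mathcal{X}^+$. With $P_1=\mathrm{span}\{\mathrm{d}x\}$, let $P_2^+$ be the smallest codistribution on $\mathcal{X}\times\mathcal{U}$ that contains $P_1\cap\mathrm{span}\{\mathrm{d}f\}$ and is invariant w.r.t. the distribution $\mathrm{span}\{\mathrm{d}f\}^\perp$ (i.e. $L_v\omega\in P_2^+$ for all $\omega\in P_2^+$, $v\in\mathrm{span}\{\mathrm{d}f\}^\perp$); it has a basis of 1-forms $\omega_i(f(x,u))\,\mathrm{d}f^i$, and $P_2$ is spanned by the backward-shifted 1-forms $\omega_i(x)\,\mathrm{d}x^i$. The condition $P_2=\mathrm{span}\{\mathrm{d}\bar x_2\}$ is equivalent to $\Delta_1=\mathrm{span}\{\partial_{\bar x_1^+}\}$. *)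

(* Defs.v *)
From HB Require Import structures.
From mathcomp Require Import all_boot all_order all_algebra.
From mathcomp Require Import all_classical all_reals all_analysis.

Set Implicit Arguments.
Unset Strict Implicit.
Unset Printing Implicit Defensive.
Import Order.TTheory GRing.Theory Num.Theory.
Import numFieldNormedType.Exports.

Local Open Scope classical_set_scope.
Local Open Scope ring_scope.

(* Conventions.  Points, tangent vectors and 1-forms of an N-dimensional
   coordinate space are row vectors; a 1-form is given by its coefficients with
   respect to the differentials of the coordinates.  The differential of g is
   v |-> v *m 'J g q, so the (i, j) entry of 'J g q is the derivative of the
   j-th component of g in the i-th coordinate.  A point (x, u) is row_mx x u.
   Maps, vector fields, (co)distributions are total functions of which only the
   germ at the base point p matters. *)

(* C^oo: all iterated directional derivatives exist and are differentiable on
   a neighborhood of p. *)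
Definition smooth_near (R : realType) (N M : nat) (p : 'rV[R]_N)
    (g : 'rV[R]_N -> 'rV[R]_M) : Prop :=
  \forall q \near p, forall vs : seq 'rV[R]_N,
    differentiable (foldr (fun v h => 'D_v h) g vs) q.

Definition local_diffeo (R : realType) (N M : nat) (p : 'rV[R]_N)
    (Psi : 'rV[R]_N -> 'rV[R]_M) (Psi' : 'rV[R]_M -> 'rV[R]_N) : Prop :=
  [/\ smooth_near p Psi, smooth_near (Psi p) Psi',
      \forall q \near p, Psi' (Psi q) = q
    & \forall y \near Psi p, Psi (Psi' y) = y].

(* Psi gives local coordinates y = Psi q with inverse q = Psi' y; the j-th
   coordinate vector field is the partial derivative of Psi' in y^j. *)
Definition coord_field (R : realType) (N M : nat)
    (Psi : 'rV[R]_N -> 'rV[R]_M) (Psi' : 'rV[R]_M -> 'rV[R]_N)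
    (j : 'I_M) (q : 'rV[R]_N) : 'rV[R]_N :=
  'D_(delta_mx 0 j) Psi' (Psi q).

Definition diff_form (R : realType) (N M : nat) (g : 'rV[R]_N -> 'rV[R]_M)
    (j : 'I_M) (q : 'rV[R]_N) : 'rV[R]_N :=
  (col j ('J g q))^T.

Definition span_at (R : realType) (N k : nat)
    (v : 'I_k -> 'rV[R]_N -> 'rV[R]_N) (q : 'rV[R]_N) : {vspace 'rV[R]_N} :=
  <<[tuple v i q | i < k]>>%VS.

Definition basis_near (R : realType) (N k : nat) (p : 'rV[R]_N)
    (D : 'rV[R]_N -> {vspace 'rV[R]_N})
    (v : 'I_k -> 'rV[R]_N -> 'rV[R]_N) : Prop :=
  \forall q \near p, basis_of (D q) [tuple v i q | i < k].

Definition sub_distr_near (R : realType) (N : nat) (p : 'rV[R]_N)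
    (D D' : 'rV[R]_N -> {vspace 'rV[R]_N}) : Prop :=
  \forall q \near p, (D q <= D' q)%VS.

Definition eq_distr_near (R : realType) (N : nat) (p : 'rV[R]_N)
    (D D' : 'rV[R]_N -> {vspace 'rV[R]_N}) : Prop :=
  \forall q \near p, D q = D' q.

(* Smooth and of constant dimension near p; used for distributions and, with
   rows read as 1-forms, for codistributions. *)
Definition distribution_near (R : realType) (N : nat) (p : 'rV[R]_N)
    (D : 'rV[R]_N -> {vspace 'rV[R]_N}) : Prop :=
  exists (k : nat) (v : 'I_k -> 'rV[R]_N -> 'rV[R]_N),
    (forall i, smooth_near p (v i)) /\ basis_near p D v.

(* v is projectable with pushforward a: in adapted coordinates
   (theta, xi) = (f, h) it reads
   a^i(theta) d/dtheta^i + b^j(theta, xi) d/dxi^j. *)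
Definition projects_to (R : realType) (n m : nat)
    (f : 'rV[R]_(n + m) -> 'rV[R]_n) (p : 'rV[R]_(n + m))
    (v : 'rV[R]_(n + m) -> 'rV[R]_(n + m)) (a : 'rV[R]_n -> 'rV[R]_n) : Prop :=
  exists (h : 'rV[R]_(n + m) -> 'rV[R]_m)
         (Psi' : 'rV[R]_(n + m) -> 'rV[R]_(n + m))
         (b : 'rV[R]_(n + m) -> 'rV[R]_m),
    let Psi := fun q => row_mx (f q) (h q) in
    [/\ local_diffeo p Psi Psi', smooth_near (f p) a, smooth_near (Psi p) b
      & \forall q \near p,
          v q = \sum_(i < n) a (f q) 0 i *: coord_field Psi Psi' (lshift m i) q
              + \sum_(j < m) b (Psi q) 0 j *:
                  coord_field Psi Psi' (rshift n j) q].

Definition projectable_near (R : realType) (n m : nat)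
    (f : 'rV[R]_(n + m) -> 'rV[R]_n) (p : 'rV[R]_(n + m))
    (D : 'rV[R]_(n + m) -> {vspace 'rV[R]_(n + m)}) : Prop :=
  exists (k : nat) (v : 'I_k -> 'rV[R]_(n + m) -> 'rV[R]_(n + m))
         (a : 'I_k -> 'rV[R]_n -> 'rV[R]_n),
    (forall i, projects_to f p (v i) (a i)) /\ basis_near p D v.

Definition is_pushforward (R : realType) (n m : nat)
    (f : 'rV[R]_(n + m) -> 'rV[R]_n) (p : 'rV[R]_(n + m))
    (D : 'rV[R]_(n + m) -> {vspace 'rV[R]_(n + m)})
    (Delta : 'rV[R]_n -> {vspace 'rV[R]_n}) : Prop :=
  exists (k : nat) (v : 'I_k -> 'rV[R]_(n + m) -> 'rV[R]_(n + m))
         (a : 'I_k -> 'rV[R]_n -> 'rV[R]_n),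
    [/\ forall i, projects_to f p (v i) (a i), basis_near p D v
      & eq_distr_near (f p) Delta (span_at a)].

Definition E0 (R : realType) (n m : nat) :
    'rV[R]_(n + m) -> {vspace 'rV[R]_(n + m)} :=
  span_at (fun (j : 'I_m) _ => delta_mx 0 (rshift n j)).

Definition is_D0 (R : realType) (n m : nat)
    (f : 'rV[R]_(n + m) -> 'rV[R]_n) (p : 'rV[R]_(n + m))
    (D0 : 'rV[R]_(n + m) -> {vspace 'rV[R]_(n + m)}) : Prop :=
  [/\ projectable_near f p D0, sub_distr_near p D0 (@E0 R n m)
    & forall D, projectable_near f p D -> sub_distr_near p D (@E0 R n m) ->
        sub_distr_near p D D0].

(* (L_v w)_j = v^i d_i w_j + w_i d_j v^i *)
Definition lie_form (R : realType) (N : nat) (v w : 'rV[R]_N -> 'rV[R]_N)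
    (q : 'rV[R]_N) : 'rV[R]_N :=
  'D_(v q) w q + w q *m ('J v q)^T.

(* v is a section, near p, of the annihilator of the codistribution Q *)
Definition annihilates_near (R : realType) (N : nat) (p : 'rV[R]_N)
    (Q : 'rV[R]_N -> {vspace 'rV[R]_N}) (v : 'rV[R]_N -> 'rV[R]_N) : Prop :=
  \forall q \near p, forall w, w \in Q q -> w *m (v q)^T = 0.

Definition invariant_perp_near (R : realType) (N : nat) (p : 'rV[R]_N)
    (P Q : 'rV[R]_N -> {vspace 'rV[R]_N}) : Prop :=
  forall w v : 'rV[R]_N -> 'rV[R]_N,
    smooth_near p w -> smooth_near p v ->
    (\forall q \near p, w q \in P q) -> annihilates_near p Q v ->
    \forall q \near p, lie_form v w q \in P q.

Definition is_P2plus (R : realType) (n m : nat)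
    (f : 'rV[R]_(n + m) -> 'rV[R]_n) (p : 'rV[R]_(n + m))
    (P : 'rV[R]_(n + m) -> {vspace 'rV[R]_(n + m)}) : Prop :=
  let P1 := span_at (fun (i : 'I_n) _ => delta_mx 0 (lshift m i)) in
  let spandf := span_at (diff_form f) in
  let admissible := fun Q =>
    [/\ distribution_near p Q,
        sub_distr_near p (fun q => (P1 q :&: spandf q)%VS) Q
      & invariant_perp_near p Q spandf] in
  admissible P /\ forall Q, admissible Q -> sub_distr_near p P Q.

(* P2plus has a basis of 1-forms w_i(f(x,u)) df^i, and P2 is spanned by the
   backward-shifted 1-forms w_i(x) dx^i. *)
Definition is_P2 (R : realType) (n m : nat)
    (f : 'rV[R]_(n + m) -> 'rV[R]_n) (p : 'rV[R]_(n + m))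
    (P2 : 'rV[R]_n -> {vspace 'rV[R]_n}) : Prop :=
  exists (P2plus : 'rV[R]_(n + m) -> {vspace 'rV[R]_(n + m)})
         (k : nat) (w : 'I_k -> 'rV[R]_n -> 'rV[R]_n),
    [/\ is_P2plus f p P2plus, forall l, smooth_near (f p) (w l),
        basis_near p P2plus
          (fun l q => \sum_(i < n) w l (f q) 0 i *: diff_form f i q)
      & eq_distr_near (f p) P2 (span_at w)].

(* ubar = Phiu(x, u), invertible w.r.t. u with inverse u = Phiu'(x, ubar) *)
Definition input_transf (R : realType) (n m m' : nat) (p : 'rV[R]_(n + m))
    (Phiu : 'rV[R]_(n + m) -> 'rV[R]_m')
    (Phiu' : 'rV[R]_(n + m') -> 'rV[R]_m) : Prop :=
  local_diffeo p (fun q => row_mx (lsubmx q) (Phiu q))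
                 (fun y => row_mx (lsubmx y) (Phiu' y)).

(* The coordinates (xbar, ubar) on X x U, and their inverse. *)
Definition xu_coord (R : realType) (n m n' m' : nat)
    (Phix : 'rV[R]_n -> 'rV[R]_n') (Phiu : 'rV[R]_(n + m) -> 'rV[R]_m')
    (q : 'rV[R]_(n + m)) : 'rV[R]_(n' + m') :=
  row_mx (Phix (lsubmx q)) (Phiu q).

Definition xu_coord_inv (R : realType) (n m n' m' : nat)
    (Phix' : 'rV[R]_n' -> 'rV[R]_n) (Phiu' : 'rV[R]_(n + m') -> 'rV[R]_m)
    (y : 'rV[R]_(n' + m')) : 'rV[R]_(n + m) :=
  let x := Phix' (lsubmx y) in row_mx x (Phiu' (row_mx x (rsubmx y))).

(* Right-hand side f_2 of the xbar_2-subsystem, as a function of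
   (xbar_1, xbar_2, u) for Phiu' = rsubmx (no input transformation), and of
   (xbar_1, xbar_2, ubar) in general. *)
Definition subsys2 (R : realType) (n m n1 n2 m' : nat)
    (f : 'rV[R]_(n + m) -> 'rV[R]_n)
    (Phix : 'rV[R]_n -> 'rV[R]_(n1 + n2)) (Phix' : 'rV[R]_(n1 + n2) -> 'rV[R]_n)
    (Phiu' : 'rV[R]_(n + m') -> 'rV[R]_m)
    (y : 'rV[R]_(n1 + n2 + m')) : 'rV[R]_n2 :=
  rsubmx (Phix (f (xu_coord_inv Phix' Phiu' y))).

(* In the coordinates (xbar, ubar_1, ubar_2), the equations of the
   xbar_2-subsystem with indices i2 read xbar_2^(i2 k),+ = ubar_2^k. *)
Definition simplified (R : realType) (n m n1 n2 m1 m2 : nat)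
    (f : 'rV[R]_(n + m) -> 'rV[R]_n) (p : 'rV[R]_(n + m))
    (Phix : 'rV[R]_n -> 'rV[R]_(n1 + n2)) (Phix' : 'rV[R]_(n1 + n2) -> 'rV[R]_n)
    (Phiu : 'rV[R]_(n + m) -> 'rV[R]_(m1 + m2))
    (Phiu' : 'rV[R]_(n + (m1 + m2)) -> 'rV[R]_m)
    (i2 : 'I_m2 -> 'I_n2) : Prop :=
  \forall y \near xu_coord Phix Phiu p, forall k : 'I_m2,
    subsys2 f Phix Phix' Phiu' y 0 (i2 k) = rsubmx (rsubmx y) 0 k.

Definition span_du1 (R : realType) (n m n1 n2 m1 m2 : nat)
    (Phix : 'rV[R]_n -> 'rV[R]_(n1 + n2)) (Phix' : 'rV[R]_(n1 + n2) -> 'rV[R]_n)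
    (Phiu : 'rV[R]_(n + m) -> 'rV[R]_(m1 + m2))
    (Phiu' : 'rV[R]_(n + (m1 + m2)) -> 'rV[R]_m) :
    'rV[R]_(n + m) -> {vspace 'rV[R]_(n + m)} :=
  span_at (fun k : 'I_m1 =>
    coord_field (xu_coord Phix Phiu) (xu_coord_inv Phix' Phiu')
      (rshift (n1 + n2) (lshift m2 k))).

(* (ubar_1, ubar_2) = Phiu(x, u) followed by
   (ubar_1, utilde_2) = (ubar_1, Phiu2(xbar, ubar_2)), and the inverse. *)
Definition refine_u2 (R : realType) (n m n' m1 m2 : nat)
    (Phix : 'rV[R]_n -> 'rV[R]_n')
    (Phiu : 'rV[R]_(n + m) -> 'rV[R]_(m1 + m2))
    (Phiu2 : 'rV[R]_(n' + m2) -> 'rV[R]_m2)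
    (q : 'rV[R]_(n + m)) : 'rV[R]_(m1 + m2) :=
  row_mx (lsubmx (Phiu q))
         (Phiu2 (row_mx (Phix (lsubmx q)) (rsubmx (Phiu q)))).

Definition refine_u2_inv (R : realType) (n m n' m1 m2 : nat)
    (Phix : 'rV[R]_n -> 'rV[R]_n')
    (Phiu' : 'rV[R]_(n + (m1 + m2)) -> 'rV[R]_m)
    (Phiu2' : 'rV[R]_(n' + m2) -> 'rV[R]_m2)
    (y : 'rV[R]_(n + (m1 + m2))) : 'rV[R]_m :=
  Phiu' (row_mx (lsubmx y)
    (row_mx (lsubmx (rsubmx y))
      (Phiu2' (row_mx (Phix (lsubmx y)) (rsubmx (rsubmx y)))))).

(* Main.v *)
(* Since 'd f is injective on E0 and maps D0 onto Delta1 = span{d/dxbar_1+}, the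
   distribution D0 consists of the vectors of E0 that are killed by the
   differential of f_2 = xbar_2+.  For (a), such vectors leave the components
   ubar_2 of f_2 constant, so they lie in span{d/dubar_1}; conversely the selected
   components of f_2 already have the full rank of d_u f_2, so a vertical vector
   that kills them kills f_2.  For (b), f_2 depends on (xbar, ubar_2) only, and its
   derivative in ubar_2 is injective; the inverse function theorem, applied to
   (xbar, ubar_2) |-> (xbar, f_2^(i2)) for m2 independent components, makes these
   components the new input utilde_2. *)
Require Import Defs.
From HB Require Import structures.
From mathcomp Require Import all_boot all_order all_algebra.
From mathcomp Require Import all_classical all_reals all_analysis.
From mathcomp Require Import ring lra.

Set Implicit Arguments.
Unset Strict Implicit.
Unset Printing Implicit Defensive.
Import Order.TTheory GRing.Theory Num.Theory.
Import numFieldNormedType.Exports.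

Local Open Scope classical_set_scope.
Local Open Scope ring_scope.

(** * Iterated differentiability *)

(** Both parts compare two pointwise descriptions: [D0] and span{d/dubar_1} each consist of the
    vertical vectors killed by one differential, that of f_2 for the former and that of ubar_2 for
    the latter. What remains in (a) is linear algebra at each point near the equilibrium. In (b) two
    matters are local rather than pointwise. A vanishing derivative in the directions ubar_1 makes
    f_2 independent of ubar_1 only along segments, hence on a ball, and the points to be compared
    must be shown to lie in that ball. Moreover, the new input needs an inverse that is again C^oo.
    The derivative of an inverse map is expressed through the inverse map itself, so its smoothness
    is obtained by induction on the order; this is why smoothness is split into the finite orders
    [diffn k] on a fixed open set. *)

Section Diffn.
Variables (R : realType) (N : nat).
Implicit Types (U : set 'rV[R]_N).

(* All iterated directional derivatives of order at most k are differentiable on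
   U, that is, g is k.+1 times differentiable there. *)
Fixpoint diffn (W : normedModType R) (k : nat) U (g : 'rV[R]_N -> W) : Prop :=
  (forall q, U q -> differentiable g q) /\
  if k is k'.+1 then forall v, diffn k' U ('D_v g) else True.

Lemma diffn_differentiable (W : normedModType R) k U (g : 'rV[R]_N -> W) q :
  diffn k U g -> U q -> differentiable g q.
Proof. by case: k => [|k] [gU _]; exact: gU. Qed.

Lemma diffn_derive (W : normedModType R) k U (g : 'rV[R]_N -> W) v :
  diffn k.+1 U g -> diffn k U ('D_v g).
Proof. by move=> [_ /(_ v)]. Qed.

Lemma diffnS (W : normedModType R) k U (g : 'rV[R]_N -> W) :
  diffn k.+1 U g -> diffn k U g.
Proof.
elim: k g => [|k IH] g [gU dg]; first by split.
by split=> // v; apply/IH/dg.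
Qed.

Lemma diffn_sub (W : normedModType R) k U V (g : 'rV[R]_N -> W) :
  V `<=` U -> diffn k U g -> diffn k V g.
Proof.
move=> VU; elim: k g => [|k IH] g [gU dg]; split=> //.
- by move=> q /VU /gU.
- by move=> q /VU /gU.
- by move=> v; apply/IH/dg.
Qed.

(** The first-order expansion of [g] at [q] is also one of [h], and [diff_unique] then identifies
    the differential of [h] with that of [g]. *)
Lemma near_eq_differentiable (W : normedModType R) (g h : 'rV[R]_N -> W) q :
  (\near q, g q = h q) -> differentiable g q -> differentiable h q.
Proof.
move=> gh /diff_locallyP[dgc dg].
have dE : h \o shift q = cst (h q) + 'd g q +o_ 0 id.
  apply/eqaddoP => e e0; move/eqaddoP : dg => /(_ e e0) ge.
  have gh' : \forall z \near (0 : 'rV[R]_N), g (z + q) = h (z + q).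
    by move: gh; rewrite (near_shift 0) subr0.
  have ghq : g q = h q by exact: nbhs_singleton gh.
  near=> z.
  have : g (z + q) = h (z + q) by near: z.
  have : `|(g \o shift q - (cst (g q) + 'd g q)) z| <= e * `|id z| by near: z.
  by rewrite !fctE /= => + <-; rewrite ghq.
have dd := diff_unique dgc dE.
by apply/diff_locallyP; rewrite dd.
Unshelve. all: by end_near. Qed.

Lemma open_near U q (P : 'rV[R]_N -> Prop) :
  open U -> U q -> (forall z, U z -> P z) -> \forall z \near q, P z.
Proof. by move=> oU Uq UP; near do apply: UP; exact: open_nbhs_nbhs.
Unshelve. all: by end_near. Qed.

(** Openness of [U] turns equality on [U] into equality near each of its points, which is what
    derivatives see. *)
Lemma eq_diffn (W : normedModType R) k U (g h : 'rV[R]_N -> W) :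
  open U -> (forall q, U q -> g q = h q) -> diffn k U g -> diffn k U h.
Proof.
move=> oU; elim: k g h => [|k IH] g h gh [gU dg]; split=> //.
- by move=> q Uq; apply: near_eq_differentiable (gU _ Uq); exact: open_near gh.
- by move=> q Uq; apply: near_eq_differentiable (gU _ Uq); exact: open_near gh.
- by move=> v; apply: IH (dg v) => q Uq; apply: near_eq_derive; exact: open_near gh.
Qed.

Lemma diffn_cst (W : normedModType R) k U (w : W) : diffn k U (cst w).
Proof.
elim: k w => [|k IH] w; split=> //.
move=> v; rewrite /=.
rewrite (_ : 'D_v _ = cst 0); first exact: IH.
by apply/funext => q; rewrite derive_cst.
Qed.

Lemma diffn_linear (W : normedModType R) k U (L : {linear 'rV[R]_N -> W}) :
  continuous L -> diffn k U L.
Proof.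
move=> cL; have dL q : differentiable L q by exact: linear_differentiable.
case: k => [|k]; split=> // v.
rewrite (_ : 'D_v _ = cst (L v)); first exact: diffn_cst.
by apply/funext => q; rewrite deriveE// diff_lin.
Qed.

Lemma derive_comp_linear (W W' : normedModType R) (L : {linear W -> W'})
    (g : 'rV[R]_N -> W) v q :
  continuous L -> differentiable g q -> 'D_v (L \o g) q = L ('D_v g q).
Proof.
move=> cL dg; have dL : differentiable L (g q) by exact: linear_differentiable.
by rewrite !deriveE//; [rewrite diff_comp//= diff_lin|exact: differentiable_comp].
Qed.

Lemma diffn_comp_linear (W W' : normedModType R) k U (L : {linear W -> W'})
    (g : 'rV[R]_N -> W) :
  open U -> continuous L -> diffn k U g -> diffn k U (L \o g).
Proof.
move=> oU cL; elim: k g => [|k IH] g [gU dg].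
  split=> // q /gU gq; apply: differentiable_comp => //.
  exact: linear_differentiable.
split=> [q /gU gq|v].
  by apply: differentiable_comp => //; exact: linear_differentiable.
apply: eq_diffn (IH _ (dg v)) => // q /gU gq.
by rewrite derive_comp_linear.
Qed.

Lemma diffnD (W : normedModType R) k U (g h : 'rV[R]_N -> W) :
  open U -> diffn k U g -> diffn k U h -> diffn k U (fun q => g q + h q).
Proof.
move=> oU; elim: k g h => [|k IH] g h [gU dg] [hU dh].
  by split=> // q Uq; apply: differentiableD; [exact: gU|exact: hU].
split=> [q Uq|v]; first by apply: differentiableD; [exact: gU|exact: hU].
apply: eq_diffn (IH _ _ (dg v) (dh v)) => // q Uq.
rewrite -[RHS](_ : 'D_v (g + h) q = _)// deriveD//; apply: diff_derivable.
- exact: gU.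
- exact: hU.
Qed.

Lemma diffn_sum (W : normedModType R) k U (I : Type) (r : seq I) (P : pred I)
    (g : I -> 'rV[R]_N -> W) :
  open U -> (forall i, P i -> diffn k U (g i)) ->
  diffn k U (fun q => \sum_(i <- r | P i) g i q).
Proof.
move=> oU dg; elim: r => [|i r IH].
  by rewrite (_ : (fun _ => _) = cst 0); [exact: diffn_cst|
    apply/funext => q; rewrite big_nil].
case: (boolP (P i)) => Pi; last first.
  by rewrite (_ : (fun _ => _) = (fun q => \sum_(i <- r | P i) g i q))//;
    apply/funext => q; rewrite big_cons (negbTE Pi).
rewrite (_ : (fun _ => _) = (fun q => g i q + \sum_(i <- r | P i) g i q)).
  by apply: diffnD => //; exact: dg.
by apply/funext => q; rewrite big_cons Pi.
Qed.

Lemma diffnM k U (g h : 'rV[R]_N -> R) :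
  open U -> diffn k U g -> diffn k U h -> diffn k U (fun q => g q * h q).
Proof.
move=> oU; elim: k g h => [|k IH] g h dg dh.
  split=> // q Uq; apply: differentiableM.
  - exact: diffn_differentiable dg _.
  - exact: diffn_differentiable dh _.
have gU q : U q -> differentiable g q by exact: diffn_differentiable dg.
have hU q : U q -> differentiable h q by exact: diffn_differentiable dh.
split=> [q Uq|v]; first by apply: differentiableM; [exact: gU|exact: hU].
apply: eq_diffn (diffnD oU (IH _ _ (diffnS dg) (diffn_derive v dh))
  (IH _ _ (diffnS dh) (diffn_derive v dg))) => // q Uq.
rewrite -[RHS](_ : 'D_v (g * h) q = _)// deriveM//; apply: diff_derivable.
- exact: gU.
- exact: hU.
Qed.

Lemma diffnZl (W : normedModType R) k U (a : 'rV[R]_N -> R) (w : W) :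
  open U -> diffn k U a -> diffn k U (fun q => a q *: w).
Proof.
move=> oU; elim: k a => [|k IH] a [aU da].
  by split=> // q Uq; apply: differentiableZl; exact: aU.
split=> [q Uq|v]; first by apply: differentiableZl; exact: aU.
apply: eq_diffn (IH _ (da v)) => // q /aU aq.
rewrite [RHS]deriveE; last exact: differentiableZl.
by rewrite diffZl// -deriveE.
Qed.

Lemma diffn_prod k U (I : Type) (r : seq I) (P : pred I)
    (g : I -> 'rV[R]_N -> R) :
  open U -> (forall i, P i -> diffn k U (g i)) ->
  diffn k U (fun q => \prod_(i <- r | P i) g i q).
Proof.
move=> oU dg; elim: r => [|i r IH].
  by rewrite (_ : (fun _ => _) = cst 1); [exact: diffn_cst|
    apply/funext => q; rewrite big_nil].
case: (boolP (P i)) => Pi; last first.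
  by rewrite (_ : (fun _ => _) = (fun q => \prod_(i <- r | P i) g i q))//;
    apply/funext => q; rewrite big_cons (negbTE Pi).
rewrite (_ : (fun _ => _) = (fun q => g i q * \prod_(i <- r | P i) g i q)).
  by apply: diffnM => //; exact: dg.
by apply/funext => q; rewrite big_cons Pi.
Qed.

Lemma diffnV k U (g : 'rV[R]_N -> R) :
  open U -> (forall q, U q -> g q != 0) -> diffn k U g ->
  diffn k U (fun q => (g q)^-1).
Proof.
move=> oU g0; elim: k => [|k IH] dg.
  by split=> // q Uq; apply: differentiableV;
    [exact: diffn_differentiable dg Uq|exact: g0].
have gU q : U q -> differentiable g q by exact: diffn_differentiable dg.
split=> [q Uq|v]; first by apply: differentiableV; [exact: gU|exact: g0].
(* The derivative of 1/g is - (1/g)^2 times that of [g]: it contains 1/g again, but only to the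
   order already reached. *)
have dV := IH (diffnS dg).
apply: eq_diffn (diffnM oU (diffn_cst k U (-1 : R))
  (diffnM oU (diffnM oU dV dV) (diffn_derive v dg)))
  => // q Uq.
rewrite -[RHS](_ : 'D_v (fun y => (g y)^-1) q = _)// deriveV ?g0//.
  by rewrite /cst mulN1r scaleNr -expr2 exprVn.
exact/diff_derivable/gU.
Qed.

Lemma diffn_det n k U (B : 'I_n -> 'I_n -> 'rV[R]_N -> R) :
  open U -> (forall i j, diffn k U (B i j)) ->
  diffn k U (fun q => \det (\matrix_(i, j) B i j q)).
Proof.
move=> oU dB; rewrite /determinant; apply: diffn_sum => // s _.
apply: diffnM => //; first exact: diffn_cst.
apply: diffn_prod => // i _.
by under eq_fun do rewrite mxE; exact: dB.
Qed.

(** Cramer's rule: an entry of the inverse is a cofactor divided by the determinant, and both are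
    polynomials in the entries of [B]. *)
Lemma diffn_invmx n k U (B : 'rV[R]_N -> 'M[R]_n) :
  open U -> (forall q, U q -> B q \in unitmx) ->
  (forall i j, diffn k U (fun q => B q i j)) ->
  forall i j, diffn k U (fun q => invmx (B q) i j).
Proof.
move=> oU BU dB i j.
have eB q : B q = \matrix_(i, j) B q i j by apply/matrixP => ? ?; rewrite mxE.
have dd : diffn k U (fun q => \det (B q)).
  by under eq_fun do rewrite eB; exact: diffn_det.
have d0 q : U q -> \det (B q) != 0 by move/BU; rewrite unitmxE unitfE.
have dc : diffn k U (fun q => cofactor (B q) j i).
  rewrite /cofactor; apply: diffnM => //; first exact: diffn_cst.
  rewrite (_ : (fun _ => _) = fun q => \det (\matrix_(a, b) B q (lift j a) (lift i b))).
    by apply: diffn_det.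
  by apply/funext => q; congr (\det _); apply/matrixP => a b; rewrite !mxE.
apply: eq_diffn (diffnM oU (diffnV oU d0 dd) dc) => // q /BU qu.
by rewrite /invmx qu !mxE.
Qed.

Lemma diffn_coord M k U (g : 'rV[R]_N -> 'rV[R]_M) : open U ->
  diffn k U g <-> forall j, diffn k U (fun q => g q 0 j).
Proof.
move=> oU; split=> [dg j|dg].
  have @L : {linear 'rV[R]_M -> R}.
    by exists (fun x : 'rV[R]_M => x 0 j); do 2![eexists]; do ?[constructor];
       rewrite ?mxE// => ? *; rewrite ?mxE//; move=> ?; rewrite !mxE.
  rewrite (_ : (fun _ => _) = L \o g)//; apply: diffn_comp_linear => //.
  exact: coord_continuous.
apply: (@eq_diffn _ _ _ (fun q => \sum_j g q 0 j *: delta_mx 0 j)) => //.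
  by move=> q _; rewrite [RHS]row_sum_delta.
apply: diffn_sum => // j _.
by apply: diffnZl.
Qed.

End Diffn.

Lemma derive_comp (R : realType) (N M : nat) (W : normedModType R)
    (g : 'rV[R]_M -> W) (f : 'rV[R]_N -> 'rV[R]_M) v q :
  differentiable f q -> differentiable g (f q) ->
  'D_v (g \o f) q = 'D_('D_v f q) g (f q).
Proof.
move=> df dg; have dgf := differentiable_comp df dg.
by rewrite (deriveE _ dgf) diff_comp//= (deriveE _ dg) (deriveE _ df).
Qed.

Lemma derive_sum_delta (R : realType) (M : nat) (W : normedModType R)
    (g : 'rV[R]_M -> W) w y :
  differentiable g y -> 'D_w g y = \sum_j w 0 j *: 'D_(delta_mx 0 j) g y.
Proof.
move=> dg; rewrite deriveE// {1}(row_sum_delta w) linear_sum.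
by apply: eq_bigr => j _; rewrite linearZ deriveE.
Qed.

(** In the chain rule [g] is differentiated in the direction ['D_v f q], which varies with [q].
    Expanding it in the fixed directions [delta_mx 0 j] gives a sum of products to which the
    induction hypothesis applies; a scalar [g] makes these products of scalar functions. *)
Lemma diffn_comp_scalar (R : realType) (N M k : nat) (U : set 'rV[R]_N) (V : set 'rV[R]_M)
    (g : 'rV[R]_M -> R) (f : 'rV[R]_N -> 'rV[R]_M) :
  open U -> open V -> (forall q, U q -> V (f q)) ->
  diffn k V g -> diffn k U f -> diffn k U (g \o f).
Proof.
move=> oU oV UV; elim: k g => [|k IH] g dg df.
  split=> // q Uq; apply: differentiable_comp.
  - exact: diffn_differentiable df Uq.
  - exact: diffn_differentiable dg (UV _ Uq).
have gV q : V q -> differentiable g q by exact: diffn_differentiable dg.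
have fU q : U q -> differentiable f q by exact: diffn_differentiable df.
split=> [q Uq|v].
  by apply: differentiable_comp; [exact: fU|exact/gV/UV].
apply: (@eq_diffn _ _ _ _ _
  (fun q => \sum_j 'D_v f q 0 j * ('D_(delta_mx 0 j) g \o f) q)) => //.
  move=> q Uq; rewrite (derive_comp v (fU _ Uq) (gV _ (UV _ Uq))).
  by rewrite [RHS](derive_sum_delta _ (gV _ (UV _ Uq))).
apply: diffn_sum => // j _; apply: diffnM => //.
  exact: (diffn_coord _ _ oU).1 (diffn_derive v df) j.
by apply: IH; [exact: diffn_derive dg|exact: diffnS].
Qed.

Lemma diffn_comp (R : realType) (N M P k : nat) (U : set 'rV[R]_N) (V : set 'rV[R]_M)
    (g : 'rV[R]_M -> 'rV[R]_P) (f : 'rV[R]_N -> 'rV[R]_M) :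
  open U -> open V -> (forall q, U q -> V (f q)) ->
  diffn k V g -> diffn k U f -> diffn k U (g \o f).
Proof.
move=> oU oV UV /(diffn_coord _ _ oV) dg df; apply/diffn_coord => // j.
exact: diffn_comp_scalar (dg j) df.
Qed.

(** A single [U] serves all orders because [smooth_near] quantifies over the lists of directions
    inside the neighborhood. *)
Lemma smooth_nearP (R : realType) (N M : nat) (p : 'rV[R]_N)
    (g : 'rV[R]_N -> 'rV[R]_M) :
  smooth_near p g <->
  exists U, [/\ open U, U p & forall k, diffn k U g].
Proof.
split=> [|[U [oU Up dg]]].
  rewrite /smooth_near /prop_near1 nbhsE => -[U [oU Up] Ug]; exists U; split=> // k.
  have {}Ug vs q : U q -> differentiable (foldr (fun v h => 'D_v h) g vs) q.
    by move/Ug; apply.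
  have : forall vs, diffn k U (foldr (fun v h => 'D_v h) g vs).
    elim: k => [|k IH] vs; first by split=> // q; exact: Ug.
    by split=> [q|v]; [exact: Ug|exact: (IH (v :: vs))].
  by move/(_ [::]).
apply: open_near Up _ => // q Uq vs.
suff : diffn 0 U (foldr (fun v h => 'D_v h) g vs) by move/diffn_differentiable; apply.
have {q Uq} : forall k, diffn k U (foldr (fun v h => 'D_v h) g vs).
  elim: vs => [|v vs IH] k; first exact: dg.
  by have [_] := IH k.+1; apply.
exact.
Qed.

(** * Mean value inequality *)

Section Norms.
Variable R : realType.

Lemma normr_rV_le (M : nat) (x : 'rV[R]_M) (c : R) :
  0 <= c -> (forall j, `|x 0 j| <= c) -> `|x| <= c.
Proof.
move=> c0 xc; rewrite [leLHS]/Num.Def.normr/= mx_normrE (bigmax_le _ c0)//=.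
by move=> [i j] _ /=; rewrite ord1.
Qed.

Lemma normr_coord_le (M : nat) (x : 'rV[R]_M) j : `|x 0 j| <= `|x|.
Proof.
by rewrite [leRHS]/Num.Def.normr/= mx_normrE; exact: (le_bigmax _ _ (0, j)).
Qed.

Lemma normr_mulmx_le (N M : nat) (v : 'rV[R]_N) (A : 'M[R]_(N, M)) (e : R) :
  0 <= e -> (forall i j, `|A i j| <= e) -> `|v *m A| <= N%:R * e * `|v|.
Proof.
move=> e0 Ae; apply: normr_rV_le => [|j]; first by rewrite !mulr_ge0.
rewrite mxE (le_trans (ler_norm_sum _ _ _))//.
rewrite [leRHS](_ : _ = \sum_(i < N) e * `|v|); last first.
  by rewrite sumr_const card_ord -mulrA mulr_natl.
apply: ler_sum => i _.
by rewrite normrM mulrC ler_pM// normr_coord_le.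
Qed.

Lemma normr_mulmx_bounded (N M : nat) (A : 'M[R]_(N, M)) :
  exists2 c : R, 0 < c & forall v : 'rV[R]_N, `|v *m A| <= c * `|v|.
Proof.
pose e := \sum_i \sum_j `|A i j|.
have e0 : 0 <= e by rewrite sumr_ge0// => i _; rewrite sumr_ge0.
exists (N%:R * e + 1) => [|v]; first by rewrite ltr_wpDl// mulr_ge0.
rewrite mulrDl mul1r (le_trans (normr_mulmx_le v e0 _)) ?lerDl// => i j.
rewrite /e (bigD1 i)//= (bigD1 j)//= -addrA lerDl addr_ge0// sumr_ge0// => k _.
by rewrite sumr_ge0.
Qed.

Lemma mulmxr_continuous (N M : nat) (A : 'M[R]_(N, M)) :
  continuous (fun v : 'rV[R]_N => v *m A).
Proof.
have [c c0 cA] := normr_mulmx_bounded A.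
move=> v; apply/(@cvgrPdist_le _ _ _ (nbhs v)) => e e0; near=> w.
rewrite -mulmxBl (le_trans (cA _))// mulrC -ler_pdivlMr//.
near: w; apply: cvgr_dist_le; first exact: cvg_id.
by rewrite divr_gt0.
Unshelve. all: by end_near. Qed.

Lemma mean_value_segment (N : nat) (g : 'rV[R]_N -> R) (a b : 'rV[R]_N) :
  (forall t : R, 0 <= t <= 1 -> differentiable g (b + t *: (a - b))) ->
  exists2 t : R, 0 <= t <= 1 & g a - g b = 'D_(a - b) g (b + t *: (a - b)).
Proof.
move=> dg; pose l (t : R) := b + t *: (a - b).
have dl (t : R) : differentiable l t.
  by apply: differentiableD => //; exact: differentiableZl.
have dlE (t : R) : 'd l t 1 = a - b.
  have lD : is_diff t l (0 + *:%R^~ (a - b)).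
    by apply: is_diffD.
  by rewrite diff_val fctE add0r scale1r.
have dgl (t : R) : 0 <= t <= 1 -> is_derive t 1 (g \o l) ('D_(a - b) g (l t)).
  move=> t01; have dgl := differentiable_comp (dl t) (dg _ t01).
  apply: DeriveDef; first exact: diff_derivable.
  by rewrite deriveE// diff_comp//=; [rewrite dlE deriveE//; exact: dg|exact: dg].
have [||t t01 E] := @MVT_segment R (g \o l) (fun t => 'D_(a - b) g (l t)) 0 1 ler01.
- by move=> t; rewrite in_itv/= => /andP[t0 t1]; apply: dgl; rewrite !ltW.
- apply: derivable_within_continuous => t; rewrite in_itv/= => t01.
  by have [] := dgl t t01.
exists t; first by move: t01; rewrite in_itv.
by move: E; rewrite /= /l scale1r scale0r addr0 subrKC subr0 mulr1.
Qed.

Lemma normr_segment_le (N : nat) (a b p : 'rV[R]_N) (t : R) :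
  0 <= t <= 1 -> `|b + t *: (a - b) - p| <= Num.max `|a - p| `|b - p|.
Proof.
move=> /andP[t0 t1].
have -> : b + t *: (a - b) - p = (1 - t) *: (b - p) + t *: (a - p).
  by rewrite scalerBl scale1r !scalerBr; apply/rowP => k; rewrite !mxE; ring.
rewrite (le_trans (ler_normD _ _))// !normrZ ger0_norm ?subr_ge0// (ger0_norm t0).
by have [xy|yx] := leP `|a - p| `|b - p|; nra.
Qed.

(** The mean value theorem gives a different intermediate point for each component of [g]. This does
    no harm, since the norm is the maximum norm and is estimated component by component. *)
Lemma mean_value_ball (N M : nat) (g : 'rV[R]_N -> 'rV[R]_M) (p : 'rV[R]_N) (r c : R) :
  (forall z, `|z - p| <= r -> differentiable g z) ->
  (forall z v, `|z - p| <= r -> `|'D_v g z| <= c * `|v|) ->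
  forall a b, `|a - p| <= r -> `|b - p| <= r -> `|g a - g b| <= c * `|a - b|.
Proof.
move=> dg cg a b ar br; apply: normr_rV_le => [|j].
  exact: le_trans (cg a (a - b) ar).
have zr (t : R) : 0 <= t <= 1 -> `|b + t *: (a - b) - p| <= r.
  by move=> t01; rewrite (le_trans (normr_segment_le _ _ _ t01))// ge_max ar br.
have dgj z : differentiable g z -> differentiable (fun q => g q 0 j) z.
  by move=> ?; apply: (differentiable_comp _ (differentiable_coord _ _ _)).
have [t t01 E] := @mean_value_segment _ (fun q => g q 0 j) a b
  (fun t t01 => dgj _ (dg _ (zr _ t01))).
have zt := zr _ t01; rewrite !mxE E.
have := cg _ (a - b) zt; rewrite derive_mx; last exact/diff_derivable/dg.
by apply: le_trans; rewrite (le_trans _ (normr_coord_le _ j))// mxE.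
Qed.

End Norms.

(** * Inverse function theorem *)

(* Completeness and norm of matrix spaces are only joined here, over a realType;
   [banach_fixed_point] needs the join. *)
HB.instance Definition _ (R : realType) (m n : nat) :=
  Uniform_isComplete.Build 'M[R]_(m, n) cauchy_cvg.

Section Jacobian.
Variable R : realType.

Lemma jacobian_delta (N M : nat) (g : 'rV[R]_N -> 'rV[R]_M) q i j :
  differentiable g q -> 'J g q i j = 'D_(delta_mx 0 i) g q 0 j.
Proof. by move=> dg; rewrite deriveEjacobian// -rowE [RHS]mxE. Qed.

Lemma jacobian_is_derive (N M : nat) (g : 'rV[R]_N -> 'rV[R]_M) q (A : 'M[R]_(N, M)) :
  differentiable g q -> (forall v, 'D_v g q = v *m A) -> 'J g q = A.
Proof.
move=> dg gA; apply/row_matrixP => i.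
by rewrite !rowE -deriveEjacobian.
Qed.

Lemma jacobian_comp (N M P : nat) (f : 'rV[R]_N -> 'rV[R]_M)
    (g : 'rV[R]_M -> 'rV[R]_P) q :
  differentiable f q -> differentiable g (f q) ->
  'J (g \o f) q = 'J f q *m 'J g (f q).
Proof.
move=> df dg; apply: jacobian_is_derive => [|v]; first exact: differentiable_comp.
by rewrite derive_comp// !deriveEjacobian// mulmxA.
Qed.

Lemma near_eq_jacobian (N M : nat) (f g : 'rV[R]_N -> 'rV[R]_M) q :
  (\near q, f q = g q) -> differentiable f q -> 'J f q = 'J g q.
Proof.
move=> fg df; have dg := near_eq_differentiable fg df.
apply: jacobian_is_derive => // v.
by rewrite (near_eq_derive _ fg) deriveEjacobian.
Qed.

Lemma jacobian_id (N : nat) (q : 'rV[R]_N) : 'J id q = 1%:M.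
Proof. by apply: jacobian_is_derive => // v; rewrite derive_id mulmx1. Qed.

Lemma diffn_jacobian (N M k : nat) (U : set 'rV[R]_N) (g : 'rV[R]_N -> 'rV[R]_M) :
  open U -> diffn k.+1 U g -> forall i j, diffn k U (fun q => 'J g q i j).
Proof.
move=> oU dg i j; have := diffn_derive (delta_mx 0 i) dg.
move/(diffn_coord _ _ oU)/(_ j); apply: eq_diffn => // q Uq.
by rewrite -jacobian_delta//; exact: diffn_differentiable dg Uq.
Qed.

(** Expanding [g] at [h y] expresses z - y by h z - h y up to o(h z - h y). Multiplying by the
    inverse Jacobian solves for h z - h y, and the Lipschitz bound turns the remainder into o(z -
    y). *)
Lemma is_diff_lipschitz_inverse (N : nat) (g h : 'rV[R]_N -> 'rV[R]_N) (y : 'rV[R]_N)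
    (c : R) :
  (\forall z \near y, g (h z) = z) -> differentiable g (h y) ->
  'J g (h y) \in unitmx -> (\forall z \near y, `|h z - h y| <= c * `|z - y|) ->
  differentiable h y /\ 'J h y = invmx ('J g (h y)).
Proof.
move=> ghK dg gu hc; set B := invmx _.
have [b b0 bB] := normr_mulmx_bounded B.
have c0 : 0 < `|c| + 1 by rewrite ltr_wpDl.
have hy : {for y, continuous h}.
  apply/(@cvgrPdist_le _ _ _ (nbhs y)) => e e0; near=> z.
  have hz : `|h z - h y| <= c * `|z - y| by near: z.
  rewrite distrC (le_trans hz)// (le_trans (ler_wpM2r _ (ler_norm c)))//.
  rewrite (@le_trans _ _ ((`|c| + 1) * `|z - y|))// ?ler_wpM2r ?lerDl//.
  rewrite mulrC -ler_pdivlMr// distrC; near: z; apply: cvgr_dist_le; first exact: cvg_id.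
  by rewrite divr_gt0.
pose L : {linear 'rV[R]_N -> 'rV[R]_N} := mulmxr B.
have dE : (h \o shift y : 'rV[R]_N -> 'rV[R]_N) =
    cst (h y) + (L : 'rV[R]_N -> 'rV[R]_N) +o_ (0 : 'rV[R]_N) id.
  apply/eqaddoP => e e0.
  (* The tolerance for [g] absorbs the bound [b] of multiplication by [B] and the Lipschitz constant
     of [h]; the summand 1 keeps the divisor positive whatever [c] is. *)
  have e1 : 0 < e / b / (`|c| + 1) by rewrite !divr_gt0.
  have /eqaddoP/(_ _ e1) := diff_locally dg => ge.
  have {}ge : \forall z \near h y,
      `|g z - g (h y) - (z - h y) *m 'J g (h y)| <= e / b / (`|c| + 1) * `|z - h y|.
    rewrite (near_shift 0) subr0; apply: filterS ge => z.
    rewrite !fctE /= /jacobian mul_rV_lin1/= addrK opprD addrA; exact.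
  have ghy : g (h y) = y by exact: nbhs_singleton ghK.
  have : \forall z \near y,
      `|g (h z) - g (h y) - (h z - h y) *m 'J g (h y)| <= e / b / (`|c| + 1) * `|h z - h y|.
    exact: (hy _ ge).
  rewrite (near_shift 0) subr0 => {}ge.
  move: hc ghK; rewrite (near_shift 0) subr0 => hc; rewrite (near_shift 0) subr0 => ghK.
  near=> z.
  have : `|g (h (z + y)) - g (h y) - (h (z + y) - h y) *m 'J g (h y)|
      <= e / b / (`|c| + 1) * `|h (z + y) - h y| by near: z.
  have -> : g (h (z + y)) = z + y by near: z.
  have : `|h (z + y) - h y| <= c * `|z + y - y| by near: z.
  rewrite ghy addrK => hz gz; rewrite !fctE/=.
  have -> : h (z + y) - (h y + z *m B) = - ((z - (h (z + y) - h y) *m 'J g (h y)) *m B).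
    by rewrite mulmxBl mulmxK// opprB opprD addrA.
  rewrite normrN (le_trans (bB _))// -ler_pdivlMl// mulrA [b^-1 * _]mulrC.
  rewrite (le_trans gz)// -mulrA ler_wpM2l//; first by rewrite divr_ge0// ltW.
  rewrite ler_pdivrMl// (le_trans hz)// ler_wpM2r// (le_trans (ler_norm c))//.
  by rewrite lerDl.
have dd := @diff_unique _ _ _ h L y (@mulmxr_continuous R N N B) dE.
have dh : differentiable h y.
  by apply/diff_locallyP; rewrite dd; split=> //; exact: mulmxr_continuous.
split=> //; apply: jacobian_is_derive => // v.
by rewrite deriveE// dd.
Unshelve. all: by end_near. Qed.

(** Bootstrapping: the Jacobian of [h] is the smooth function [invmx ('J g q)] composed with [h], so
    [h] gains one order over what is known of it. *)
Lemma diffn_inverse (N k : nat) (U V : set 'rV[R]_N) (g h : 'rV[R]_N -> 'rV[R]_N) :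
  open U -> open V -> (forall y, V y -> U (h y)) ->
  (forall k, diffn k U g) -> (forall q, U q -> 'J g q \in unitmx) ->
  (forall y, V y -> differentiable h y /\ 'J h y = invmx ('J g (h y))) ->
  diffn k V h.
Proof.
move=> oU oV VU dg gu dh; elim: k => [|k IH].
  by split=> // y /dh[].
split=> [y /dh[]//|v]; apply/diffn_coord => // j.
apply: (@eq_diffn _ _ _ _ _
  (fun y => \sum_i v 0 i * ((fun q => invmx ('J g q) i j) \o h) y)) => //.
  move=> y /dh[hy hJ]; rewrite deriveEjacobian// hJ mxE.
  by apply: eq_bigr.
apply: diffn_sum => // i _; apply: diffnM => //; first exact: diffn_cst.
apply: (diffn_comp_scalar oV oU) IH => //.
by apply: diffn_invmx => // a b; exact: diffn_jacobian.
Qed.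

(** The map [T] below has Jacobian [A q], which vanishes at [p], so it contracts by 1/2 on a small
    ball. Banach's theorem yields the inverse there, the contraction estimate its Lipschitz bound,
    and the two preceding lemmas its smoothness. *)
Lemma inverse_function (N : nat) (g : 'rV[R]_N -> 'rV[R]_N) (p : 'rV[R]_N) :
  smooth_near p g -> 'J g p \in unitmx -> exists h, local_diffeo p g h.
Proof.
move=> smg gu; have /smooth_nearP[U0 [oU0 U0p dg]] := smg.
have dgU q : U0 q -> differentiable g q by exact: diffn_differentiable (dg 0%N).
pose B := invmx ('J g p).
pose A q := 1%:M - 'J g q *m B.
have detC : {for p, continuous (fun q => \det ('J g q))}.
  apply: differentiable_continuous.
  have := @diffn_det R N N 0 U0 (fun i j q => 'J g q i j) oU0
    (diffn_jacobian oU0 (dg 1%N)).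
  move=> /diffn_differentiable/(_ U0p); congr (differentiable _ _).
  apply/funext => q; congr (\det _).
  by apply/matrixP => i j; rewrite mxE.
have nearu : \forall q \near p, 'J g q \in unitmx.
  have d0 : \det ('J g p) != 0 by rewrite -unitfE -unitmxE.
  near=> q; rewrite unitmxE unitfE; near: q.
  exact: (cvgr_neq0 _ detC d0).
(* A matrix with entries at most [e] multiplies norms by at most N e, and this choice makes N e <=
   1/2; the summand 1 covers N = 0. *)
pose e : R := (2 * N%:R + 1)^-1.
have e0 : 0 < e by rewrite invr_gt0 ltr_wpDl// mulr_ge0.
have nearA : \forall q \near p, forall i j, `|A q i j| <= e.
  suff : \forall q \near p, forall ij : 'I_N * 'I_N, `|A q ij.1 ij.2| <= e.
    by apply: filterS => q Aq i j; exact: (Aq (i, j)).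
  apply: (@filter_forall _ ('I_N * 'I_N)%type (fun ij q => `|A q ij.1 ij.2| <= e)
    (nbhs p)) => -[i j] /=.
  have Ac : {for p, continuous (fun q => A q i j)}.
    apply: differentiable_continuous.
    apply: (@diffn_differentiable _ _ _ 0 U0) => //.
    rewrite (_ : (fun q => _) =
      (fun q => (1%:M : 'M[R]_N) i j + (-1) * \sum_k 'J g q i k * B k j)).
      apply: (diffnD oU0 (@diffn_cst R N R 0 U0 ((1%:M : 'M[R]_N) i j))).
      apply: (diffnM oU0 (@diffn_cst R N R 0 U0 (-1))).
      apply: diffn_sum => // k _.
      apply: (diffnM oU0 _ (@diffn_cst R N R 0 U0 (B k j))).
      exact: diffn_jacobian.
    by apply/funext => q; rewrite mxE [X in _ + X]mxE [X in - X]mxE mulN1r.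
  have Ap : A p i j = 0 by rewrite /A mulmxV// subrr mxE.
  near=> q; rewrite -normrN -[- _]sub0r -Ap; near: q.
  by apply: cvgr_dist_le; [exact: Ac|exact: e0].
have /nbhs_normP[r0 /= r00 r0P] : nbhs p [set q | [/\ U0 q, 'J g q \in unitmx
    & forall i j, `|A q i j| <= e]].
  near=> q; split; near: q => //; exact: open_nbhs_nbhs.
pose r := r0 / 2.
have rgt0 : 0 < r by rewrite divr_gt0.
have rP q : `|q - p| <= r -> [/\ U0 q, 'J g q \in unitmx
    & forall i j, `|A q i j| <= e].
  move=> qr; apply: r0P => /=; rewrite distrC (le_lt_trans qr)//.
  by rewrite /r; lra.
(* Solutions of g q = y are the fixed points of q |-> y *m B + T q. *)
pose T q := q - g q *m B.
have TD q v : U0 q -> differentiable T q /\ 'D_v T q = v *m A q.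
  move=> /dgU gq; have gB : differentiable (fun q => g q *m B) q.
    exact: (differentiable_comp gq (@linear_differentiable R _ _ (mulmxr B) (g q)
      (@mulmxr_continuous R N N B))).
  split; first by apply: differentiableB.
  rewrite (deriveB (@derivable_id _ _ q v) (diff_derivable gB)) derive_id.
  rewrite (@derive_comp_linear _ _ _ _ (mulmxr B) g v q (@mulmxr_continuous R N N B) gq)/=.
  by rewrite deriveEjacobian// /A mulmxBr mulmx1 mulmxA.
have TL a b : `|a - p| <= r -> `|b - p| <= r -> `|T a - T b| <= 2^-1 * `|a - b|.
  apply: mean_value_ball => [z /rP[Uz _ _]|z v /rP[Uz _ Az]].
    by have [] := TD z 0 Uz.
  have [_ ->] := TD z v Uz.
  rewrite (le_trans (normr_mulmx_le _ (ltW e0) Az))// ler_wpM2r//.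
  rewrite /e ler_pdivrMr ?ltr_wpDl ?mulr_ge0//.
  have : 0 <= N%:R :> R by [].
  by lra.
have [b b0 bB] := normr_mulmx_bounded B.
(* For [y] in [V], the shift by [y] moves [p] by at most r/2 and the contraction contributes another
   r/2, so the closed ball of radius [r] is mapped into itself. *)
pose V := (fun y : 'rV[R]_N => y *m B) @^-1` ball (g p *m B) (r / 2).
have VE y : V y <-> `|(y - g p) *m B| < r / 2.
  by rewrite /V/= -ball_normE/= distrC mulmxBl.
have oV : open V by apply: open_comp (ball_open _ _) => y _; exact: mulmxr_continuous.
(* The difference q1 - q2 is T q1 - T q2 plus (y1 - y2) *m B, and the first term is at most half of
   its norm. This gives both injectivity of [g] and the Lipschitz bound of the inverse. *)
have lip y1 y2 q1 q2 : `|q1 - p| <= r -> `|q2 - p| <= r -> g q1 = y1 -> g q2 = y2 ->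
    `|q1 - q2| <= 2 * `|(y1 - y2) *m B|.
  move=> q1r q2r <- <-; have := TL _ _ q1r q2r.
  have -> : T q1 - T q2 = (q1 - q2) - (g q1 - g q2) *m B.
    by rewrite /T mulmxBl !opprB; apply/rowP => k; rewrite !mxE; ring.
  have := ler_normB ((q1 - q2) - (g q1 - g q2) *m B) (- ((g q1 - g q2) *m B)).
  by rewrite opprK subrK normrN; lra.
(* The condition [V y] stands under the existential so that choice produces a total map [h]; outside
   [V] any witness will do. *)
have ex y : exists q, V y -> `|q - p| < r /\ g q = y.
  have [Vy|nVy] := pselect (V y); last by exists 0.
  pose F q := y *m B + T q.
  pose K := closed_ball p r.
  have KE q : K q <-> `|q - p| <= r.
    by rewrite /K closed_ballE// /closed_ball_/= distrC.
  have FK : {homo F : q / K q >-> K q}.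
    move=> q /KE qr; apply/KE.
    have -> : F q - p = (y - g p) *m B + (T q - T p).
      by rewrite /F /T mulmxBl; apply/rowP => k; rewrite !mxE; ring.
    rewrite (le_trans (ler_normD _ _))//.
    have pr : `|p - p| <= r by rewrite subrr normr0 ltW.
    have := TL _ _ qr pr; move: Vy => /VE Vy TT.
    have : 2^-1 * `|q - p| <= 2^-1 * r by rewrite ler_wpM2l// invr_ge0.
    by lra.
  have half0 : 0 <= (2^-1 : R) by rewrite invr_ge0.
  have [||q Kq qF] := @banach_fixed_point R _ K (mkfun FK) _ (@closed_ball_closed _ _ _ _).
  - exists (NngNum half0); split; first by rewrite /= invf_lt1// ltr1n.
    move=> [q1 q2] [/KE q1r /KE q2r] /=.
    by rewrite /F opprD addrACA subrr add0r; exact: TL.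
  - by exists p; apply/KE; rewrite subrr normr0 ltW.
  have gq : g q = y.
    have : (y - g q) *m B = 0.
      rewrite mulmxBl; transitivity (y *m B + (q - g q *m B) - q).
        by apply/rowP => k; rewrite !mxE; ring.
      by rewrite -[y *m B + _]qF subrr.
    move/(congr1 (mulmx^~ ('J g p))); rewrite mulmxKV// mul0mx.
    by move/eqP; rewrite subr_eq0 => /eqP.
  exists q => _; split=> //.
  have pr : `|p - p| <= r by rewrite subrr normr0 ltW.
  (* The fixed point is so far only in the closed ball; comparison with [p] puts it in the open one,
     since 2 times r/2 is a strict bound. *)
  have := lip _ _ _ _ (proj1 (KE q) Kq) pr gq erefl.
  by move: Vy => /VE; lra.
pose h y := sval (cid (ex y)).
have hP y : V y -> `|h y - p| < r /\ g (h y) = y := svalP (cid (ex y)).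
have Vgp : V (g p) by apply/VE; rewrite subrr mul0mx normr0 divr_gt0.
pose U := [set q | `|q - p| < r].
have oU : open U.
  have -> : U = ball p r.
    by apply/seteqP; split=> q; rewrite -ball_normE /U /ball_/= distrC.
  exact: ball_open.
have UU0 q : U q -> U0 q /\ 'J g q \in unitmx.
  by move=> /ltW/rP[].
exists h; split=> //.
- apply/smooth_nearP; exists V; split=> // k.
  apply: (@diffn_inverse N k U V g h oU oV).
  + by move=> y /hP[].
  + by move=> k'; apply: diffn_sub (dg k') => q /UU0[].
  + by move=> q /UU0[].
  + move=> y Vy; have [hyr ghy] := hP _ Vy; have [U0y uy] := UU0 _ hyr.
    apply: (@is_diff_lipschitz_inverse N g h y (2 * b)); [|exact: dgU|exact: uy|].
    * by apply: open_near oV Vy _ => z /hP[].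
    * apply: open_near oV Vy _ => z /hP[zr gz].
      rewrite (le_trans (lip _ _ _ _ (ltW zr) (ltW hyr) gz ghy))//.
      by rewrite -mulrA ler_wpM2l.
- have gc : {for p, continuous g} by apply/differentiable_continuous/dgU.
  have Vg : \forall q \near p, V (g q).
    by apply: (gc V); exact: open_nbhs_nbhs.
  have Uq : \forall q \near p, U q.
    by apply: open_nbhs_nbhs; split=> //; rewrite /U/= subrr normr0.
  near=> q.
  have /hP[hr ghq] : V (g q) by near: q.
  have qr : U q by near: q.
  apply/eqP; rewrite -subr_eq0 -normr_le0.
  by rewrite (le_trans (lip _ _ _ _ (ltW hr) (ltW qr) ghq erefl))// subrr mul0mx normr0 mulr0.
- by apply: open_near oV Vgp _ => y /hP[].
Unshelve. all: by end_near. Qed.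

End Jacobian.

(** * Germs of smooth maps and local coordinates *)

Section SmoothNear.
Variable R : realType.

Lemma smooth_near_differentiable (N M : nat) (p : 'rV[R]_N) (g : 'rV[R]_N -> 'rV[R]_M) :
  smooth_near p g -> \forall q \near p, differentiable g q.
Proof. by apply: filterS => q /(_ [::]). Qed.

Lemma smooth_near_continuous (N M : nat) (p : 'rV[R]_N) (g : 'rV[R]_N -> 'rV[R]_M) :
  smooth_near p g -> {for p, continuous g}.
Proof.
move/smooth_near_differentiable/nbhs_singleton.
exact: differentiable_continuous.
Qed.

Lemma smooth_near_near (N M : nat) (p : 'rV[R]_N) (y : 'rV[R]_M)
    (g : 'rV[R]_N -> 'rV[R]_M) (P : 'rV[R]_M -> Prop) :
  smooth_near p g -> g p = y -> (\forall z \near y, P z) -> \forall q \near p, P (g q).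
Proof. by move=> /smooth_near_continuous gc <- Py; exact: (gc _ Py). Qed.

Lemma near_eq_smooth_near (N M : nat) (p : 'rV[R]_N) (g h : 'rV[R]_N -> 'rV[R]_M) :
  (\forall q \near p, g q = h q) -> smooth_near p g -> smooth_near p h.
Proof.
rewrite /prop_near1 nbhsE => -[V [oV Vp] gh] /smooth_nearP[U [oU Up dg]].
apply/smooth_nearP; exists (U `&` V); split=> //; first exact: openI.
move=> k; apply: (@eq_diffn _ _ _ _ _ g); first exact: openI.
  by move=> q [_ /gh].
by apply: diffn_sub (dg k) => q [].
Qed.

Lemma smooth_near_comp (N M P : nat) (p : 'rV[R]_N) (f : 'rV[R]_N -> 'rV[R]_M)
    (g : 'rV[R]_M -> 'rV[R]_P) :
  smooth_near p f -> smooth_near (f p) g -> smooth_near p (g \o f).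
Proof.
move=> smf /smooth_nearP[V [oV Vfp dg]].
have := smooth_near_continuous smf (open_nbhs_nbhs (conj oV Vfp)).
rewrite nbhsE => -[W [oW Wp] WV]; have /smooth_nearP[U [oU Up df]] := smf.
apply/smooth_nearP; exists (U `&` W); split=> //; first exact: openI.
move=> k; apply: (@diffn_comp _ _ _ _ _ _ V) => //; first exact: openI.
- by move=> q [_ /WV].
- by apply: diffn_sub (df k) => q [].
Qed.

Lemma smooth_near_linear (N M : nat) (p : 'rV[R]_N) (L : {linear 'rV[R]_N -> 'rV[R]_M}) :
  continuous L -> smooth_near p L.
Proof.
move=> cL; apply/smooth_nearP; exists setT; split=> //; first exact: openT.
by move=> k; exact: diffn_linear.
Qed.

Lemma smooth_near_cst (N M : nat) (p : 'rV[R]_N) (c : 'rV[R]_M) :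
  smooth_near p (fun=> c).
Proof.
apply/smooth_nearP; exists setT; split=> //; first exact: openT.
by move=> k; exact: diffn_cst.
Qed.

Lemma smooth_near_id (N : nat) (p : 'rV[R]_N) : smooth_near p id.
Proof. by apply: (@smooth_near_linear _ _ _ idfun) => x. Qed.

Lemma smooth_near_coord (N M : nat) (p : 'rV[R]_N) (g : 'rV[R]_N -> 'rV[R]_M)
    (P : nat) (s : 'I_P -> 'I_M) :
  smooth_near p g -> smooth_near p (fun q => \row_k g q 0 (s k)).
Proof.
move=> /smooth_nearP[U [oU Up dg]]; apply/smooth_nearP; exists U; split=> // k.
apply/diffn_coord => // j; under eq_fun do rewrite mxE.
exact: (diffn_coord _ _ oU).1 (dg k) _.
Qed.

Lemma smooth_near_row_mx (N M P : nat) (p : 'rV[R]_N) (f : 'rV[R]_N -> 'rV[R]_M)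
    (g : 'rV[R]_N -> 'rV[R]_P) :
  smooth_near p f -> smooth_near p g -> smooth_near p (fun q => row_mx (f q) (g q)).
Proof.
move=> /smooth_nearP[U [oU Up df]] /smooth_nearP[V [oV Vp dg]].
apply/smooth_nearP; exists (U `&` V); have oUV := openI oU oV; split=> // k.
apply/diffn_coord => // j; case: (split_ordP j) => i ->.
  under eq_fun do rewrite row_mxEl.
  by apply: (diffn_coord _ _ oUV).1; apply: diffn_sub (df k) => q [].
under eq_fun do rewrite row_mxEr.
by apply: (diffn_coord _ _ oUV).1; apply: diffn_sub (dg k) => q [].
Qed.

Lemma smooth_near_lsubmx (N M P : nat) (p : 'rV[R]_N) (f : 'rV[R]_N -> 'rV[R]_(M + P)) :
  smooth_near p f -> smooth_near p (fun q => lsubmx (f q)).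
Proof.
move=> smf; apply: (@smooth_near_comp _ _ _ _ f lsubmx smf).
exact/smooth_near_linear/continuous_lsubmx.
Qed.

Lemma smooth_near_rsubmx (N M P : nat) (p : 'rV[R]_N) (f : 'rV[R]_N -> 'rV[R]_(M + P)) :
  smooth_near p f -> smooth_near p (fun q => rsubmx (f q)).
Proof.
move=> smf; apply: (@smooth_near_comp _ _ _ _ f rsubmx smf).
exact/smooth_near_linear/continuous_rsubmx.
Qed.

Lemma derive_lsubmx (N M P : nat) (f : 'rV[R]_N -> 'rV[R]_(M + P)) v q :
  differentiable f q -> 'D_v (fun z => lsubmx (f z)) q = lsubmx ('D_v f q).
Proof. exact: derive_comp_linear (@continuous_lsubmx _ _ _ _). Qed.

Lemma derive_rsubmx (N M P : nat) (f : 'rV[R]_N -> 'rV[R]_(M + P)) v q :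
  differentiable f q -> 'D_v (fun z => rsubmx (f z)) q = rsubmx ('D_v f q).
Proof. exact: derive_comp_linear (@continuous_rsubmx _ _ _ _). Qed.

Lemma derive_row_mx (N M P : nat) (f : 'rV[R]_N -> 'rV[R]_M) (g : 'rV[R]_N -> 'rV[R]_P) v q :
  differentiable (fun z => row_mx (f z) (g z)) q ->
  'D_v (fun z => row_mx (f z) (g z)) q = row_mx ('D_v f q) ('D_v g q).
Proof.
move=> dfg; rewrite -[LHS]hsubmxK -(derive_lsubmx v dfg) -(derive_rsubmx v dfg).
under eq_fun do rewrite row_mxKl.
by under [X in row_mx _ ('D_v X q)]eq_fun do rewrite row_mxKr.
Qed.

Lemma derive_coord (N M : nat) (g : 'rV[R]_N -> 'rV[R]_M) v q j :
  differentiable g q -> 'D_v (fun z => g z 0 j) q = ('D_v g q) 0 j.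
Proof. by move=> dg; rewrite derive_mx ?mxE//; exact: diff_derivable. Qed.

(** The pointwise content of [local_diffeo]. Both products of Jacobians are recorded because the
    dimensions [N] and [M], such as [n] and [n1 + n2], are different terms. *)
Definition inverse_at (N M : nat) (Psi : 'rV[R]_N -> 'rV[R]_M)
    (Psi' : 'rV[R]_M -> 'rV[R]_N) (q : 'rV[R]_N) : Prop :=
  [/\ differentiable Psi q, differentiable Psi' (Psi q), Psi' (Psi q) = q,
    'J Psi q *m 'J Psi' (Psi q) = 1%:M & 'J Psi' (Psi q) *m 'J Psi q = 1%:M].

Lemma local_diffeo_inverse_at (N M : nat) (p : 'rV[R]_N) (Psi : 'rV[R]_N -> 'rV[R]_M)
    (Psi' : 'rV[R]_M -> 'rV[R]_N) :
  local_diffeo p Psi Psi' -> \forall q \near p, inverse_at Psi Psi' q.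
Proof.
move=> [smP smP' PK P'K]; have Pc := smooth_near_continuous smP.
have dP := smooth_near_differentiable smP.
have dP' := Pc _ (smooth_near_differentiable smP').
(* To be differentiated at [q], the inverse identities must hold on a neighborhood of [q];
   [near_join] provides this for all [q] near [p]. *)
have P'KK := Pc _ (near_join P'K); have PKK := near_join PK.
near=> q; have dPq : differentiable Psi q by near: q.
have dP'q : differentiable Psi' (Psi q) by near: q.
have E : Psi' (Psi q) = q by near: q.
split=> //.
  rewrite -jacobian_comp// -[RHS](jacobian_id q); apply: near_eq_jacobian.
    by near: q.
  exact: differentiable_comp.
have dP2 : differentiable Psi (Psi' (Psi q)) by rewrite E.
rewrite -{2}E -jacobian_comp// -[RHS](jacobian_id (Psi q)).
apply: near_eq_jacobian; last exact: differentiable_comp.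
by near: q.
Unshelve. all: by end_near. Qed.

Lemma coord_fieldE (N M : nat) (Psi : 'rV[R]_N -> 'rV[R]_M) (Psi' : 'rV[R]_M -> 'rV[R]_N)
    j q :
  differentiable Psi' (Psi q) -> coord_field Psi Psi' j q = row j ('J Psi' (Psi q)).
Proof. by move=> dP; rewrite /coord_field deriveEjacobian// rowE. Qed.

Lemma span_atP (N k : nat) (v : 'I_k -> 'rV[R]_N -> 'rV[R]_N) q w :
  w \in span_at v q <-> exists c : 'I_k -> R, w = \sum_i c i *: v i q.
Proof.
split=> [wv|[c ->]].
  exists (coord [tuple v i q | i < k] ^~ w); rewrite {1}(coord_span wv).
  by apply: eq_bigr => i _; rewrite -tnth_nth tnth_mktuple.
apply: memv_suml => i _; apply/memvZ/memv_span.
by apply/mapP; exists i => //; rewrite mem_enum.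
Qed.

(** Since [B] is inverse to [A], [w *m B] lists the coordinates of [w] in the basis formed by the
    rows of [A]. This single criterion serves E0, Delta1 and span{d/dubar_1}. *)
Lemma span_at_rows (N M k : nat) (v : 'I_k -> 'rV[R]_N -> 'rV[R]_N) q
    (A : 'M[R]_(M, N)) (B : 'M[R]_(N, M)) (s : 'I_k -> 'I_M) w :
  A *m B = 1%:M -> B *m A = 1%:M -> (forall i, v i q = row (s i) A) ->
  w \in span_at v q <-> forall j, j \notin codom s -> (w *m B) 0 j = 0.
Proof.
move=> AB BA vA; split=> [/span_atP[c ->] j js|w0].
  rewrite mulmx_suml summxE big1// => i _.
  rewrite vA -scalemxAl -row_mul AB !mxE.
  case: eqP => [E|_]; last by rewrite mulr0.
  by rewrite -E codom_f in js.
rewrite -[w]mulmx1 -BA mulmxA mulmx_sum_row; apply: memv_suml => j _.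
have [/codomP[i ->]|/w0 ->] := boolP (j \in codom s); last by rewrite scale0r mem0v.
rewrite -vA; apply/memvZ/memv_span.
by apply/mapP; exists i => //; rewrite mem_enum.
Qed.

Lemma mem_E0 (n m : nat) (q v : 'rV[R]_(n + m)) : v \in E0 q <-> lsubmx v = 0.
Proof.
rewrite (@span_at_rows _ _ _ _ _ 1%:M 1%:M (@rshift n m)) ?mulmx1//; last first.
  by move=> i; rewrite rowE mulmx1.
split=> [v0|v0 j jn].
  apply/rowP => i; rewrite !mxE v0//; apply/codomP => -[j /eqP].
  by rewrite eq_lrshift.
case: (split_ordP j) jn => i ->; last by rewrite codom_f.
by move=> _; have /rowP/(_ i) := v0; rewrite !mxE.
Qed.

(** In the adapted coordinates [f] is the projection to the first block, which reads off the
    components [a]; the auxiliary [h] and [b] thus disappear. *)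
Lemma projects_to_derive (n m : nat) (f : 'rV[R]_(n + m) -> 'rV[R]_n) p v a :
  projects_to f p v a -> \forall q \near p, 'D_(v q) f q = a (f q).
Proof.
move=> [h [Psi' [b /= [ld _ _ vE]]]]; pose Psi q := row_mx (f q) (h q).
have := local_diffeo_inverse_at ld; rewrite -/Psi in vE * => J.
near=> q.
have [dP dP' _ _ J'J] : inverse_at Psi Psi' q by near: q.
have vqE : v q = \sum_(i < n) a (f q) 0 i *: coord_field Psi Psi' (lshift m i) q
              + \sum_(j < m) b (Psi q) 0 j *:
                  coord_field Psi Psi' (rshift n j) q by near: q.
have vJ : v q = row_mx (a (f q)) (b (Psi q)) *m 'J Psi' (Psi q).
  rewrite mulmx_sum_row big_split_ord vqE; congr (_ + _); apply: eq_bigr => i _.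
    by rewrite row_mxEl coord_fieldE.
  by rewrite row_mxEr coord_fieldE.
rewrite (_ : f = fun z => lsubmx (Psi z)); last first.
  by apply/funext => z; rewrite row_mxKl.
by rewrite derive_lsubmx// deriveEjacobian// vJ -mulmxA J'J mulmx1 !row_mxKl.
Unshelve. all: by end_near. Qed.

End SmoothNear.

(** * Vertical vectors and the distribution D0 *)

Section Coordinates.
Variables (R : realType) (n m n1 n2 : nat).
Variables (f : 'rV[R]_(n + m) -> 'rV[R]_n) (p : 'rV[R]_(n + m)).
Variables (Phix : 'rV[R]_n -> 'rV[R]_(n1 + n2)) (Phix' : 'rV[R]_(n1 + n2) -> 'rV[R]_n).
Hypothesis f_smooth : smooth_near p f.

(* 'd f is injective on E0 and maps D0 onto Delta1: a vertical vector whose image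
   lies in Delta1 differs from an element of D0 by a vertical vector killed by
   'd f, hence lies in D0. *)
Lemma mem_D0 (D0 : 'rV[R]_(n + m) -> {vspace 'rV[R]_(n + m)})
    (Delta1 : 'rV[R]_n -> {vspace 'rV[R]_n}) :
  local_diffeo (f p) Phix Phix' ->
  (\forall q \near p, \rank (dsubmx ('J f q)) = m) ->
  sub_distr_near p D0 (@E0 R n m) ->
  is_pushforward f p D0 Delta1 ->
  eq_distr_near (f p) Delta1
    (span_at (fun k : 'I_n1 => coord_field Phix Phix' (lshift n2 k))) ->
  \forall q \near p, forall w, w \in D0 q <->
    lsubmx w = 0 /\ 'D_w (fun z => rsubmx (Phix (f z))) q = 0.
Proof.
move=> ld rank_u D0E [k [v [a [va bD aD]]]] D1E.
have fc := smooth_near_continuous f_smooth.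
have df := smooth_near_differentiable f_smooth.
have {}aD := fc _ aD; have {}D1E := fc _ D1E.
have J : \forall q \near p, inverse_at Phix Phix' (f q).
  have := @smooth_near_near _ _ _ p (f p) f (inverse_at Phix Phix') f_smooth erefl.
  by apply; exact: local_diffeo_inverse_at.
have {}va : \forall q \near p, forall i, 'D_(v i q) f q = a i (f q).
  apply: (@filter_forall _ _ (fun i q => 'D_(v i q) f q = a i (f q)) (nbhs p)) => i.
  exact: projects_to_derive (va i).
near=> q => w.
have dfq : differentiable f q by near: q.
have [dP dP' _ JJ' J'J] : inverse_at Phix Phix' (f q) by near: q.
have rk : \rank (dsubmx ('J f q)) = m by near: q.
have D0Eq : (D0 q <= @E0 R n m q)%VS by near: q.
have aDq : Delta1 (f q) = span_at a (f q) by near: q.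
have D1q : Delta1 (f q) =
    span_at (fun k : 'I_n1 => coord_field Phix Phix' (lshift n2 k)) (f q) by near: q.
have vaq : forall i, 'D_(v i q) f q = a i (f q) by near: q.
have bq : basis_of (D0 q) [tuple v i q | i < k] by near: q.
have D0w u : u \in D0 q <-> exists c : 'I_k -> R, u = \sum_i c i *: v i q.
  by rewrite -(span_basis bq); exact: span_atP.
have F2E u : 'D_u (fun z => rsubmx (Phix (f z))) q
    = rsubmx ('D_u f q *m 'J Phix (f q)).
  have dPf : differentiable (Phix \o f) q by exact: differentiable_comp.
  by rewrite (derive_rsubmx _ dPf) derive_comp// deriveEjacobian.
have D1w u : u \in Delta1 (f q) <-> rsubmx (u *m 'J Phix (f q)) = 0.
  rewrite D1q (@span_at_rows _ _ _ _ _ _ _ _ (@lshift n1 n2) u J'J JJ'); last first.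
    by move=> i; exact: coord_fieldE.
  split=> [u0|u0 j jn].
    apply/rowP => i; rewrite mxE u0 ?mxE//; apply/codomP => -[j /eqP].
    by rewrite eq_rlshift.
  case: (split_ordP j) jn => i ->; first by rewrite codom_f.
  by move=> _; have /rowP/(_ i) := u0; rewrite mxE => ->; rewrite mxE.
have Dsum (c : 'I_k -> R) : 'D_(\sum_i c i *: v i q) f q = \sum_i c i *: a i (f q).
  rewrite deriveE// linear_sum; apply: eq_bigr => i _.
  by rewrite linearZ -deriveE// vaq.
rewrite F2E -D1w aDq; split=> [wD|[w0 /span_atP[c wc]]].
  split; first by apply/mem_E0/(subvP D0Eq).
  have /D0w[c ->] := wD; apply/span_atP; exists c; exact: Dsum.
(* The coefficients of the image of [w] in the [a i] are reused on the [v i], which gives an element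
   of [D0] with the same image. *)
pose w' := \sum_i c i *: v i q.
have w'D : w' \in D0 q by apply/D0w; exists c.
have w'0 : lsubmx w' = 0 by apply/mem_E0/(subvP D0Eq).
suff -> : w = w' by [].
apply/eqP; rewrite -subr_eq0; apply/eqP; set d := w - w'.
have d0 : lsubmx d = 0 by rewrite /d linearB/= w0 w'0 subr0.
have : d *m 'J f q = 0.
  by rewrite mulmxBl -!deriveEjacobian// wc Dsum subrr.
rewrite -[d]hsubmxK d0 -['J f q]vsubmxK mul_row_col mul0mx add0r.
have rf : row_free (dsubmx ('J f q)) by rewrite /row_free rk.
by move/eqP; rewrite mulmx_free_eq0// => /eqP ->; rewrite row_mx0.
Unshelve. all: by end_near. Qed.

Variables (m' : nat) (Phiu : 'rV[R]_(n + m) -> 'rV[R]_m')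
  (Phiu' : 'rV[R]_(n + m') -> 'rV[R]_m).
Hypothesis ldx : local_diffeo (lsubmx p) Phix Phix'.
Hypothesis ldu : input_transf p Phiu Phiu'.

Lemma smooth_near_input : smooth_near p Phiu.
Proof.
have [sm _ _ _] := ldu.
apply: near_eq_smooth_near (smooth_near_rsubmx sm); near=> q.
by rewrite row_mxKr.
Unshelve. all: by end_near. Qed.

Lemma local_diffeo_xu_coord :
  local_diffeo p (xu_coord Phix Phiu) (xu_coord_inv Phix' Phiu').
Proof.
have [smx smx' xK x'K] := ldx; have [smu smu' uK u'K] := ldu.
have xc := smooth_near_continuous (smooth_near_lsubmx (@smooth_near_id R _ p)).
have lr : smooth_near p (fun q => Phix (lsubmx q)).
  by apply: smooth_near_comp smx; exact/smooth_near_lsubmx/smooth_near_id.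
set y := xu_coord Phix Phiu p.
have yE : lsubmx y = Phix (lsubmx p) by rewrite row_mxKl.
have smx'l : smooth_near y (fun z => Phix' (lsubmx z)).
  apply: (@smooth_near_comp _ _ _ _ _ lsubmx Phix'); last by rewrite yE.
  exact/smooth_near_lsubmx/smooth_near_id.
have x'y : Phix' (lsubmx y) = lsubmx p by rewrite yE (nbhs_singleton xK).
(* [e] undoes the state transformation alone, so the full inverse is the inverse input
   transformation after [e]. *)
pose e z : 'rV[R]_(n + m') := row_mx (Phix' (lsubmx z)) (rsubmx z).
have ey : e y = row_mx (lsubmx p) (Phiu p) by rewrite /e x'y row_mxKr.
have sme : smooth_near y e.
  by apply: smooth_near_row_mx => //; exact/smooth_near_rsubmx/smooth_near_id.
have sminv : smooth_near y (xu_coord_inv Phix' Phiu').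
  have -> : xu_coord_inv Phix' Phiu' =
      (fun z => row_mx (lsubmx z) (Phiu' z)) \o e.
    by apply/funext => z; rewrite /xu_coord_inv /e /= row_mxKl.
  by apply: (smooth_near_comp sme); rewrite ey.
split=> //; first by apply: smooth_near_row_mx => //; exact: smooth_near_input.
- have xKl : \forall q \near p, Phix' (Phix (lsubmx q)) = lsubmx q by exact: xc xK.
  near=> q; rewrite /xu_coord_inv /xu_coord/= row_mxKl row_mxKr.
  have -> : Phix' (Phix (lsubmx q)) = lsubmx q by near: q.
  have : row_mx (lsubmx (row_mx (lsubmx q) (Phiu q))) (Phiu' (row_mx (lsubmx q) (Phiu q))) = q.
    by near: q.
  by rewrite row_mxKl.
- have u'Ke := smooth_near_near sme ey u'K.
  have x'Kl := smooth_near_near (smooth_near_lsubmx (@smooth_near_id R _ y)) yE x'K.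
  near=> z; rewrite /xu_coord_inv /xu_coord/= row_mxKl.
  have -> : Phix (Phix' (lsubmx z)) = lsubmx z by near: z.
  have : row_mx (lsubmx (row_mx (lsubmx (e z)) (Phiu' (e z))))
      (Phiu (row_mx (lsubmx (e z)) (Phiu' (e z)))) = e z by near: z.
  rewrite !row_mxKl => /eq_row_mx[_].
  by rewrite /e => ->; rewrite hsubmxK.
Unshelve. all: by end_near. Qed.

Lemma derive_xu_coord : \forall q \near p, forall w,
  'D_w (xu_coord Phix Phiu) q =
    row_mx (lsubmx w *m 'J Phix (lsubmx q)) ('D_w Phiu q).
Proof.
have [smx _ _ _] := ldx; have [smxu _ _ _] := local_diffeo_xu_coord.
have dxu := smooth_near_differentiable smxu.
have dx := smooth_near_continuous (smooth_near_lsubmx (@smooth_near_id R _ p))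
  (smooth_near_differentiable smx).
near=> q => w.
have dq : differentiable (xu_coord Phix Phiu) q by near: q.
have dxq : differentiable Phix (lsubmx q) by near: q.
rewrite derive_row_mx//; congr row_mx.
have dl : differentiable (lsubmx : 'rV[R]_(n + m) -> _) q by exact: differentiable_lsubmx.
have did := nbhs_singleton (smooth_near_differentiable (smooth_near_id q)).
rewrite (derive_comp w dl dxq) deriveEjacobian// (derive_lsubmx w did).
by rewrite derive_id.
Unshelve. all: by end_near. Qed.

End Coordinates.

(** The counterpart of [mem_D0], with d ubar_2 in the place of d f_2: a vector is a combination of
    the d/dubar_1 exactly when its xbar and ubar_2 components vanish. *)
Lemma mem_span_du1 (R : realType) (n m n1 n2 m1 m2 : nat) (p : 'rV[R]_(n + m))
    (Phix : 'rV[R]_n -> 'rV[R]_(n1 + n2)) (Phix' : 'rV[R]_(n1 + n2) -> 'rV[R]_n)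
    (Phiu : 'rV[R]_(n + m) -> 'rV[R]_(m1 + m2))
    (Phiu' : 'rV[R]_(n + (m1 + m2)) -> 'rV[R]_m) :
  local_diffeo (lsubmx p) Phix Phix' -> input_transf p Phiu Phiu' ->
  \forall q \near p, forall w, w \in span_du1 Phix Phix' Phiu Phiu' q <->
    lsubmx w = 0 /\ rsubmx ('D_w Phiu q) = 0.
Proof.
move=> ldx ldu; have J := local_diffeo_inverse_at (local_diffeo_xu_coord ldx ldu).
have D := derive_xu_coord ldx ldu.
have Jx : \forall q \near p, 'J Phix (lsubmx q) *m 'J Phix' (Phix (lsubmx q)) = 1%:M.
  have := smooth_near_near (smooth_near_lsubmx (smooth_near_id p)) erefl
    (local_diffeo_inverse_at ldx).
  by apply: filterS => q [].
near=> q => w.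
have [dP dP' _ JJ' J'J] : inverse_at (xu_coord Phix Phiu) (xu_coord_inv Phix' Phiu') q
    by near: q.
have Dq : forall w, 'D_w (xu_coord Phix Phiu) q =
    row_mx (lsubmx w *m 'J Phix (lsubmx q)) ('D_w Phiu q) by near: q.
have Jxq : 'J Phix (lsubmx q) *m 'J Phix' (Phix (lsubmx q)) = 1%:M by near: q.
rewrite /span_du1 (@span_at_rows _ _ _ _ _ _ _ _
  (fun k => rshift (n1 + n2) (lshift m2 k)) w J'J JJ'); last first.
  by move=> i; exact: coord_fieldE.
rewrite -deriveEjacobian// Dq; split=> [w0|[w0 u0] j jn].
  split.
    rewrite -[lsubmx w]mulmx1 -Jxq mulmxA (_ : lsubmx w *m _ = 0) ?mul0mx//.
    apply/rowP => i; rewrite [RHS]mxE.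
    have := w0 (lshift _ i); rewrite row_mxEl; apply.
    by apply/codomP => -[j /eqP]; rewrite eq_lrshift.
  apply/rowP => i; rewrite !mxE.
  have := w0 (rshift _ (rshift _ i)); rewrite row_mxEr; apply.
  by apply/codomP => -[j /eqP]; rewrite (inj_eq (@rshift_inj _ _)) eq_rlshift.
case: (split_ordP j) jn => i -> jn; first by rewrite row_mxEl w0 mul0mx mxE.
rewrite row_mxEr; case: (split_ordP i) jn => l -> jn.
  by case/codomP: jn; exists l.
by have /rowP/(_ l) := u0; rewrite !mxE.
Unshelve. all: by end_near. Qed.

(** Dropping columns can only enlarge the left kernel; equal ranks give equal dimensions, hence
    equal kernels. *)
Lemma colsub_rank_ker (F : fieldType) (m n k : nat) (A : 'M[F]_(m, n)) (s : 'I_k -> 'I_n)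
    (u : 'rV[F]_m) :
  \rank (colsub s A) = \rank A -> u *m colsub s A = 0 -> u *m A = 0.
Proof.
move=> rk /sub_kermxP us; apply/sub_kermxP; apply: submx_trans us _.
have AB : (kermx A <= kermx (colsub s A))%MS.
  apply/sub_kermxP; rewrite -[A in colsub s A]mulmx1 -mulmx_colsub mulmxA mulmx_ker.
  by rewrite mul0mx.
by rewrite -(geq_leqif (mxrank_leqif_sup AB)) !mxrank_ker rk.
Qed.

(** * The map f_2 in the coordinates (xbar, ubar) *)

Lemma smooth_near_subsys2 (R : realType) (n m n1 n2 m' : nat)
    (f : 'rV[R]_(n + m) -> 'rV[R]_n) (p : 'rV[R]_(n + m))
    (Phix : 'rV[R]_n -> 'rV[R]_(n1 + n2)) (Phix' : 'rV[R]_(n1 + n2) -> 'rV[R]_n)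
    (Phiu : 'rV[R]_(n + m) -> 'rV[R]_m') (Phiu' : 'rV[R]_(n + m') -> 'rV[R]_m) :
  smooth_near p f -> smooth_near (f p) Phix ->
  local_diffeo (lsubmx p) Phix Phix' -> input_transf p Phiu Phiu' ->
  smooth_near (xu_coord Phix Phiu p) (subsys2 f Phix Phix' Phiu').
Proof.
move=> smf smx ldx ldu; have [_ smi iK _] := local_diffeo_xu_coord ldx ldu.
have ip := nbhs_singleton iK.
apply: smooth_near_rsubmx; apply: (@smooth_near_comp _ _ _ _ _ _ Phix); last by rewrite ip.
by apply: (smooth_near_comp smi); rewrite ip.
Qed.

(** The chain rule for [subsys2] after [xu_coord], which near [p] is f_2 as a function on X x U. It
    carries the description of [D0] over to the coordinates (xbar, ubar). *)
Lemma derive_subsys2 (R : realType) (n m n1 n2 m' : nat)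
    (f : 'rV[R]_(n + m) -> 'rV[R]_n) (p : 'rV[R]_(n + m))
    (Phix : 'rV[R]_n -> 'rV[R]_(n1 + n2)) (Phix' : 'rV[R]_(n1 + n2) -> 'rV[R]_n)
    (Phiu : 'rV[R]_(n + m) -> 'rV[R]_m') (Phiu' : 'rV[R]_(n + m') -> 'rV[R]_m) :
  smooth_near p f -> smooth_near (f p) Phix ->
  local_diffeo (lsubmx p) Phix Phix' -> input_transf p Phiu Phiu' ->
  \forall q \near p, forall w, 'D_w (fun z => rsubmx (Phix (f z))) q =
    'D_(row_mx (lsubmx w *m 'J Phix (lsubmx q)) ('D_w Phiu q))
      (subsys2 f Phix Phix' Phiu') (xu_coord Phix Phiu q).
Proof.
move=> smf smx ldx ldu; have [smxu _ /near_join iK _] := local_diffeo_xu_coord ldx ldu.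
have dS := smooth_near_near smxu erefl
  (smooth_near_differentiable (smooth_near_subsys2 smf smx ldx ldu)).
have dxu := smooth_near_differentiable smxu.
have D := derive_xu_coord ldx ldu.
near=> q => w.
have Dq : forall w, 'D_w (xu_coord Phix Phiu) q =
    row_mx (lsubmx w *m 'J Phix (lsubmx q)) ('D_w Phiu q) by near: q.
have dq : differentiable (xu_coord Phix Phiu) q by near: q.
have dSq : differentiable (subsys2 f Phix Phix' Phiu') (xu_coord Phix Phiu q) by near: q.
rewrite -Dq -derive_comp//; apply: near_eq_derive.
have : \forall z \near q, xu_coord_inv Phix' Phiu' (xu_coord Phix Phiu z) = z by near: q.
by apply: filterS => z; rewrite /subsys2/= => ->.
Unshelve. all: by end_near. Qed.

(** Makes the original input [u] an instance of the general ubar, as the rank condition of (a) is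
    stated for d_u f_2. *)
Lemma input_transf_id (R : realType) (n m : nat) (p : 'rV[R]_(n + m)) :
  input_transf p (@rsubmx R 1 n m) rsubmx.
Proof.
rewrite /input_transf; have -> : (fun q : 'rV[R]_(n + m) => row_mx (lsubmx q) (rsubmx q)) = id.
  by apply/funext => q; rewrite hsubmxK.
by split; [exact: smooth_near_id|exact: smooth_near_id|exact: filterE|exact: filterE].
Qed.

(** * Part (a): selected components of f_2 as inputs *)

Lemma D0_of_simplified (R : realType) (n m n1 n2 m1 m2 : nat) (m12 : (m1 + m2)%N = m)
    (f : 'rV[R]_(n + m) -> 'rV[R]_n) (p : 'rV[R]_(n + m))
    (Phix : 'rV[R]_n -> 'rV[R]_(n1 + n2)) (Phix' : 'rV[R]_(n1 + n2) -> 'rV[R]_n)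
    (Phiu : 'rV[R]_(n + m) -> 'rV[R]_(m1 + m2))
    (Phiu' : 'rV[R]_(n + (m1 + m2)) -> 'rV[R]_m)
    (D0 : 'rV[R]_(n + m) -> {vspace 'rV[R]_(n + m)}) (i2 : 'I_m2 -> 'I_n2) :
  smooth_near p f -> smooth_near (f p) Phix -> local_diffeo (lsubmx p) Phix Phix' ->
  (\forall q \near p, forall w, w \in D0 q <->
    lsubmx w = 0 /\ 'D_w (fun z => rsubmx (Phix (f z))) q = 0) ->
  input_transf p Phiu Phiu' ->
  (\forall z \near xu_coord Phix rsubmx p,
     \rank (dsubmx ('J (subsys2 f Phix Phix' rsubmx) z)) = m2) ->
  simplified f p Phix Phix' Phiu Phiu' i2 ->
  eq_distr_near p D0 (span_du1 Phix Phix' Phiu Phiu').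
Proof.
move=> smf smx ldx D0w ldu rk simp; pose F2 z := rsubmx (Phix (f z)).
have ldi := input_transf_id p.
have [smxu _ iK _] := local_diffeo_xu_coord ldx ldu.
have [smxi _ _ _] := local_diffeo_xu_coord ldx ldi.
have smF : smooth_near p F2 by exact/smooth_near_rsubmx/(smooth_near_comp smf).
have F2E : \forall q \near p, forall k, F2 q 0 (i2 k) = rsubmx (Phiu q) 0 k.
  have := smooth_near_near smxu erefl simp.
  apply: filterS2 iK => q iq Sq k; have := Sq k.
  by rewrite /subsys2 iq /F2 => ->; rewrite row_mxKr.
have {}F2E := near_join F2E.
have DS := derive_subsys2 smf smx ldx ldi.
have rkS := smooth_near_near smxi erefl rk.
have dS := smooth_near_near smxi erefl
  (smooth_near_differentiable (smooth_near_subsys2 smf smx ldx ldi)).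
have dF := smooth_near_differentiable smF.
have dPu := smooth_near_differentiable (smooth_near_input ldu).
have du1 := mem_span_du1 ldx ldu.
have J := local_diffeo_inverse_at (local_diffeo_xu_coord ldx ldu).
have D := derive_xu_coord ldx ldu.
near=> q.
have D0q : forall w, w \in D0 q <-> lsubmx w = 0 /\ 'D_w F2 q = 0 by near: q.
have du1q : forall w, w \in span_du1 Phix Phix' Phiu Phiu' q <->
    lsubmx w = 0 /\ rsubmx ('D_w Phiu q) = 0 by near: q.
have F2q : \forall z \near q, forall k, F2 z 0 (i2 k) = rsubmx (Phiu z) 0 k by near: q.
have dFq : differentiable F2 q by near: q.
have dPuq : differentiable Phiu q by near: q.
have D2 w k : 'D_w F2 q 0 (i2 k) = rsubmx ('D_w Phiu q) 0 k.
  rewrite -derive_coord// mxE -derive_coord//; apply: near_eq_derive.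
  by apply: filterS F2q => z ->; rewrite mxE.
(* By [D2] the selected components of d f_2 are d ubar_2, so one inclusion is immediate; the other
   needs that these components have the full rank of d_u f_2. *)
suff rank_eq : \rank (colsub i2 (dsubmx ('J F2 q))) = \rank (dsubmx ('J F2 q)).
  have DF w : lsubmx w = 0 -> 'D_w F2 q = rsubmx w *m dsubmx ('J F2 q).
    move=> w0; rewrite deriveEjacobian// -{1}[w]hsubmxK w0 -{1}['J F2 q]vsubmxK.
    by rewrite mul_row_col mul0mx add0r.
  apply/vspaceP => w; apply/idP/idP => [/D0q[w0 Dw]|/du1q[w0 Dw]].
    apply/du1q; split=> //; apply/rowP => k.
    by rewrite -D2 Dw !mxE.
  apply/D0q; split=> //; rewrite DF//; apply: colsub_rank_ker rank_eq _.
  rewrite mulmx_colsub -DF//; apply/rowP => k.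
  by rewrite mxE D2 Dw mxE.
(* The rank hypothesis refers to the coordinates (xbar, u). Replacing x by xbar leaves the vertical
   directions (0, u) unchanged, so the two input blocks coincide. *)
have -> : \rank (dsubmx ('J F2 q)) = m2.
  have <- : \rank (dsubmx ('J (subsys2 f Phix Phix' rsubmx) (xu_coord Phix rsubmx q))) = m2.
    by near: q.
  have dSq : differentiable (subsys2 f Phix Phix' rsubmx) (xu_coord Phix rsubmx q) by near: q.
  have DSq : forall w, 'D_w F2 q =
    'D_(row_mx (lsubmx w *m 'J Phix (lsubmx q)) ('D_w rsubmx q))
      (subsys2 f Phix Phix' rsubmx) (xu_coord Phix rsubmx q) by near: q.
  congr (\rank _); apply/row_matrixP => i; rewrite !rowE.
  have := DSq (row_mx 0 (delta_mx 0 i)).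
  rewrite row_mxKl mul0mx.
  rewrite (derive_rsubmx _ (nbhs_singleton (smooth_near_differentiable (smooth_near_id q)))).
  rewrite derive_id row_mxKr !deriveEjacobian// -['J F2 q]vsubmxK.
  rewrite -['J (subsys2 _ _ _ _) _]vsubmxK !mul_row_col !mul0mx !add0r.
  by rewrite !col_mxKd.
have [dP dP' _ JJ' J'J] : inverse_at (xu_coord Phix Phiu) (xu_coord_inv Phix' Phiu') q
    by near: q.
have Dq : forall w, 'D_w (xu_coord Phix Phiu) q =
    row_mx (lsubmx w *m 'J Phix (lsubmx q)) ('D_w Phiu q) by near: q.
pose C := dsubmx ('J Phiu q).
have uC u : u *m C = 'D_(row_mx 0 u) Phiu q.
  rewrite deriveEjacobian// -['J Phiu q]vsubmxK mul_row_col mul0mx add0r.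
  by rewrite ?col_mxKd.
(* A vertical vector killed by d Phiu would be killed by the whole coordinate change. By [m12] the
   block [C] is square, hence invertible, so its last [m2] columns are independent. *)
have Cfree : row_free C.
  rewrite -kermx_eq0; apply/rowV0P => u /sub_kermxP; rewrite uC => Du.
  have := Dq (row_mx 0 u); rewrite Du row_mxKl mul0mx row_mx0 deriveEjacobian//.
  move=> /(congr1 (mulmx^~ ('J (xu_coord_inv Phix' Phiu') (xu_coord Phix Phiu q)))).
  rewrite -mulmxA JJ' mulmx1 mul0mx => /(congr1 rsubmx).
  by rewrite row_mxKr linear0.
have Cfull : row_full C by rewrite /row_full (eqP Cfree) m12.
have [X XC] := row_fullP Cfull.
have -> : colsub i2 (dsubmx ('J F2 q)) = rsubmx C.
  apply/row_matrixP => i; apply/rowP => k.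
  have := D2 (row_mx 0 (delta_mx 0 i)) k.
  rewrite -uC -rowE deriveEjacobian// -['J F2 q]vsubmxK mul_row_col mul0mx add0r -rowE.
  rewrite ?col_mxKd; move: (dsubmx ('J F2 q)) (C) => A B.
  by rewrite !mxE.
apply/eqP; rewrite eqn_leq rank_leq_col/=.
apply: leq_trans (mxrankM_maxr X _).
rewrite rsubmxEsub mulmx_colsub XC -rsubmxEsub scalar_mx_block block_mxEh row_mxKr.
by rewrite rank_col_0mx mxrank1.
Unshelve. all: by end_near. Qed.

(** * Part (b): construction of the new input *)

(** Balls are convex: the segment from [b] to [a] stays where the derivative in the constant
    direction a - b vanishes. *)
Lemma near_eq_of_derive0 (R : realType) (N M : nat) (p : 'rV[R]_N)
    (g : 'rV[R]_N -> 'rV[R]_M) (K : 'rV[R]_N -> Prop) :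
  (\forall z \near p, differentiable g z /\ forall w, K w -> 'D_w g z = 0) ->
  exists2 B : set 'rV[R]_N, nbhs p B & forall a b, B a -> B b -> K (a - b) -> g a = g b.
Proof.
move=> /nbhs_normP[r /= r0 rP]; exists (ball p r); first exact: nbhsx_ballx.
move=> a b; rewrite -ball_normE /= => ar br Kab; apply/rowP => j.
have zr (t : R) : 0 <= t <= 1 -> `|p - (b + t *: (a - b))| < r.
  move=> t01; rewrite distrC (le_lt_trans (normr_segment_le _ _ _ t01))//.
  by rewrite gt_max -!(distrC p) ar br.
have dg t (t01 : 0 <= t <= 1) := (rP _ (zr t t01)).1.
have Dg t (t01 : 0 <= t <= 1) := (rP _ (zr t t01)).2 _ Kab.
have [t t01 E] := @mean_value_segment R N (fun q => g q 0 j) a b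
  (fun t t01 => differentiable_comp (dg t t01) (differentiable_coord _ _ _)).
apply/eqP; rewrite -subr_eq0 E derive_coord ?Dg ?mxE//; exact: dg.
Qed.

Lemma simplified_of_D0 (R : realType) (n m n1 n2 m1 m2 : nat)
    (f : 'rV[R]_(n + m) -> 'rV[R]_n) (p : 'rV[R]_(n + m))
    (Phix : 'rV[R]_n -> 'rV[R]_(n1 + n2)) (Phix' : 'rV[R]_(n1 + n2) -> 'rV[R]_n)
    (Phiu : 'rV[R]_(n + m) -> 'rV[R]_(m1 + m2))
    (Phiu' : 'rV[R]_(n + (m1 + m2)) -> 'rV[R]_m)
    (D0 : 'rV[R]_(n + m) -> {vspace 'rV[R]_(n + m)}) :
  smooth_near p f -> smooth_near (f p) Phix -> local_diffeo (lsubmx p) Phix Phix' ->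
  (\forall q \near p, forall w, w \in D0 q <->
    lsubmx w = 0 /\ 'D_w (fun z => rsubmx (Phix (f z))) q = 0) ->
  input_transf p Phiu Phiu' ->
  eq_distr_near p D0 (span_du1 Phix Phix' Phiu Phiu') ->
  exists (Phiu2 Phiu2' : 'rV[R]_(n1 + n2 + m2) -> 'rV[R]_m2) (i2 : 'I_m2 -> 'I_n2),
    [/\ input_transf (row_mx (Phix (lsubmx p)) (rsubmx (Phiu p))) Phiu2 Phiu2',
        injective i2
      & simplified f p Phix Phix'
          (refine_u2 Phix Phiu Phiu2) (refine_u2_inv Phix Phiu' Phiu2') i2].
Proof.
move=> smf smx ldx D0w ldu D0E; pose G := subsys2 f Phix Phix' Phiu'.
pose y0 := xu_coord Phix Phiu p.
have smG : smooth_near y0 G by exact: smooth_near_subsys2.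
have [smxu smi iK iK'] := local_diffeo_xu_coord ldx ldu.
(* 'd G kills exactly the directions ubar_1 among the ubar. *)
have kerG : \forall y \near y0, forall w, lsubmx w = 0 ->
    ('D_w G y = 0 <-> rsubmx (rsubmx w) = 0).
  have DS := derive_subsys2 smf smx ldx ldu.
  have J := local_diffeo_inverse_at (local_diffeo_xu_coord ldx ldu).
  have D := derive_xu_coord ldx ldu.
  have du1 := mem_span_du1 ldx ldu.
  have Jx : \forall q \near p, 'J Phix (lsubmx q) *m 'J Phix' (Phix (lsubmx q)) = 1%:M.
    have := smooth_near_near (smooth_near_lsubmx (smooth_near_id p)) erefl
      (local_diffeo_inverse_at ldx).
    by apply: filterS => q [].
  suff : \forall q \near p, forall w, lsubmx w = 0 ->
      ('D_w G (xu_coord Phix Phiu q) = 0 <-> rsubmx (rsubmx w) = 0).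
    move/(smooth_near_near smi (nbhs_singleton iK)) => H.
    by apply: filterS2 iK' H => y ->.
  near=> q => w w0.
  have [dP dP' _ JJ' J'J] : inverse_at (xu_coord Phix Phiu) (xu_coord_inv Phix' Phiu') q
    by near: q.
  have Dq : forall w, 'D_w (xu_coord Phix Phiu) q =
      row_mx (lsubmx w *m 'J Phix (lsubmx q)) ('D_w Phiu q) by near: q.
  have DSq : forall w, 'D_w (fun z => rsubmx (Phix (f z))) q =
      'D_(row_mx (lsubmx w *m 'J Phix (lsubmx q)) ('D_w Phiu q)) G (xu_coord Phix Phiu q)
    by near: q.
  have D0q : forall w, w \in D0 q <->
    lsubmx w = 0 /\ 'D_w (fun z => rsubmx (Phix (f z))) q = 0 by near: q.
  have du1q : forall w, w \in span_du1 Phix Phix' Phiu Phiu' q <->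
    lsubmx w = 0 /\ rsubmx ('D_w Phiu q) = 0 by near: q.
  have DE : D0 q = span_du1 Phix Phix' Phiu Phiu' q by near: q.
  have Jxq : 'J Phix (lsubmx q) *m 'J Phix' (Phix (lsubmx q)) = 1%:M by near: q.
  (* [v] is the tangent vector at [q] whose components in the coordinates (xbar, ubar) are [w]; it
     is vertical because [w] has no xbar part. *)
  pose v := w *m 'J (xu_coord_inv Phix' Phiu') (xu_coord Phix Phiu q).
  have vw : row_mx (lsubmx v *m 'J Phix (lsubmx q)) ('D_v Phiu q) = w.
    by rewrite -Dq deriveEjacobian// -mulmxA J'J mulmx1.
  have v0 : lsubmx v = 0.
    rewrite -[lsubmx v]mulmx1 -Jxq mulmxA (_ : lsubmx v *m _ = 0) ?mul0mx//.
    by rewrite -w0 -vw row_mxKl.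
  rewrite -{1}vw -DSq -[w in rsubmx (rsubmx w)]vw row_mxKr.
  split=> [Dv|Dv].
    have /du1q[] : v \in span_du1 Phix Phix' Phiu Phiu' q by rewrite -DE; apply/D0q.
    by [].
  by have /D0q[] : v \in D0 q by rewrite DE; apply/du1q.
(* Since G does not depend on ubar_1, freeze ubar_1 at its value c0 at p. *)
pose c0 := lsubmx (Phiu p).
pose e (z : 'rV[R]_(n1 + n2 + m2)) := row_mx (lsubmx z) (row_mx c0 (rsubmx z)).
pose g z := G (e z).
pose z0 := row_mx (Phix (lsubmx p)) (rsubmx (Phiu p)).
have ez0 : e z0 = y0 by rewrite /e row_mxKl row_mxKr hsubmxK.
have sme z : smooth_near z e.
  apply: smooth_near_row_mx; first exact/smooth_near_lsubmx/smooth_near_id.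
  apply: smooth_near_row_mx; first exact: smooth_near_cst.
  exact/smooth_near_rsubmx/smooth_near_id.
have smg : smooth_near z0 g by apply: (smooth_near_comp (sme z0)); rewrite ez0.
have dg := nbhs_singleton (smooth_near_differentiable smg).
have De u : 'D_(row_mx 0 u) e z0 = row_mx 0 (row_mx 0 u).
  have dez := nbhs_singleton (smooth_near_differentiable (sme z0)).
  have dr : differentiable (fun z : 'rV[R]_(n1 + n2 + m2) => row_mx c0 (rsubmx z)) z0.
    apply: (nbhs_singleton (smooth_near_differentiable _)).
    apply: (@smooth_near_row_mx _ _ _ _ _ (fun=> c0)); first exact: smooth_near_cst.
    exact/smooth_near_rsubmx/smooth_near_id.
  have did := nbhs_singleton (smooth_near_differentiable (smooth_near_id z0)).
  rewrite derive_row_mx// derive_row_mx// (derive_lsubmx _ did) (derive_rsubmx _ did).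
  by rewrite derive_id row_mxKl row_mxKr derive_cst.
pose A := dsubmx ('J g z0).
have DgA w : lsubmx w = 0 -> 'D_w g z0 = rsubmx w *m A.
  move=> w0; rewrite deriveEjacobian// -{1}[w]hsubmxK w0 -{1}['J g z0]vsubmxK.
  by rewrite mul_row_col mul0mx add0r.
have Afree : row_free A.
  rewrite -kermx_eq0; apply/rowV0P => u /sub_kermxP uA.
  have : 'D_(row_mx 0 u) g z0 = 0 by rewrite DgA ?row_mxKl// row_mxKr.
  have dez := nbhs_singleton (smooth_near_differentiable (sme z0)).
  rewrite derive_comp//; last first.
    by rewrite ez0; exact: nbhs_singleton (smooth_near_differentiable smG).
  rewrite De ez0 => /(nbhs_singleton kerG).
  by rewrite row_mxKl !row_mxKr => ->.
(* [A] is the derivative of f_2 in ubar_2 at the base point, and its rows are independent by [kerG].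
   So [m2] of its columns form an invertible minor; their indices are the equations [i2]. *)
have AT : row_full A^T by rewrite /row_full mxrank_tr.
pose i2 : 'I_m2 -> 'I_n2 := fullrankfun AT.
have i2A : colsub i2 A \in unitmx.
  have := fullrowsub_unit AT.
  by rewrite -unitmx_tr /i2; congr (_ \in unitmx); apply/matrixP => i j; rewrite !mxE.
pose Phiu2 z : 'rV[R]_m2 := \row_k g z 0 (i2 k).
pose Psi z := row_mx (lsubmx z) (Phiu2 z).
have smu2 : smooth_near z0 Phiu2 by exact: smooth_near_coord.
have smPsi : smooth_near z0 Psi.
  by apply: smooth_near_row_mx => //; exact/smooth_near_lsubmx/smooth_near_id.
(* The Jacobian is block triangular, with the identity for xbar and the invertible minor for
   ubar_2. *)
have JPsi : 'J Psi z0 \in unitmx.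
  have dPsi := nbhs_singleton (smooth_near_differentiable smPsi).
  have dPhi := nbhs_singleton (smooth_near_differentiable smu2).
  rewrite -row_free_unit -kermx_eq0; apply/rowV0P => w /sub_kermxP.
  have did := nbhs_singleton (smooth_near_differentiable (smooth_near_id z0)).
  rewrite -deriveEjacobian// derive_row_mx// (derive_lsubmx _ did) derive_id.
  rewrite -[X in _ = X]row_mx0 => /eq_row_mx[w0].
  have -> : 'D_w Phiu2 z0 = rsubmx w *m colsub i2 A.
    rewrite mulmx_colsub -DgA//; apply/rowP => k.
    rewrite [RHS]mxE -(derive_coord w k dPhi) -(derive_coord w (i2 k) dg).
    by under [X in 'D_w X _ = _]eq_fun do rewrite mxE.
  move=> /(congr1 (mulmx^~ (invmx (colsub i2 A)))); rewrite mulmxK// mul0mx => w1.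
  by rewrite -[w]hsubmxK w0 w1 row_mx0.
have [h ldh] := inverse_function smPsi JPsi.
have [_ smh hK hK'] := ldh; pose Phiu2' z : 'rV[R]_m2 := rsubmx (h z).
(* [Psi] preserves xbar, hence so does its inverse; this gives [h] the shape that [input_transf]
   prescribes. *)
have hE : \forall z \near Psi z0, h z = row_mx (lsubmx z) (Phiu2' z).
  apply: filterS hK' => z hz.
  have <- : lsubmx (h z) = lsubmx z by rewrite -[in RHS]hz /Psi row_mxKl.
  by rewrite hsubmxK.
exists Phiu2, Phiu2', i2; split.
- split=> //.
  + exact: near_eq_smooth_near smh.
  + apply: filterS2 hK (smooth_near_near smPsi erefl hE) => z hz E.
    by rewrite -[RHS]hz E.
  + by apply: filterS2 hK' hE => z hz E; rewrite -[RHS]hz E.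
- exact: fullrankfun_inj.
rewrite /simplified; set y1 := xu_coord _ _ p.
have idl y : smooth_near y (fun z : 'rV[R]_(n1 + n2 + (m1 + m2)) => lsubmx z).
  exact/smooth_near_lsubmx/smooth_near_id.
have idr y : smooth_near y (fun z : 'rV[R]_(n1 + n2 + (m1 + m2)) => rsubmx z).
  exact/smooth_near_rsubmx/smooth_near_id.
have y1E : y1 = row_mx (Phix (lsubmx p)) (row_mx c0 (Phiu2 z0)) by [].
have [_ _ _ x'K] := ldx.
have x'K1 : \forall y \near y1, Phix (Phix' (lsubmx y)) = lsubmx y.
  by apply: (smooth_near_near (idl y1) _ x'K); rewrite y1E row_mxKl.
pose t (y : 'rV[R]_(n1 + n2 + (m1 + m2))) := row_mx (lsubmx y) (rsubmx (rsubmx y)).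
have smt : smooth_near y1 t.
  by apply: smooth_near_row_mx => //; exact: smooth_near_rsubmx.
have ty1 : t y1 = Psi z0 by rewrite /t y1E /Psi !row_mxKl !row_mxKr.
have hKt := smooth_near_near smt ty1 hK'; have hEt := smooth_near_near smt ty1 hE.
have smu2t : smooth_near y1 (fun y => Phiu2' (t y)).
  by apply: smooth_near_rsubmx; apply: (smooth_near_comp smt); rewrite ty1.
pose s (y : 'rV[R]_(n1 + n2 + (m1 + m2))) :=
  row_mx (lsubmx y) (row_mx (lsubmx (rsubmx y)) (Phiu2' (t y))).
have sms : smooth_near y1 s.
  apply: smooth_near_row_mx => //; apply: smooth_near_row_mx => //.
  exact: smooth_near_lsubmx.
have u2y1 : Phiu2' (t y1) = rsubmx (Phiu p).
  by rewrite /Phiu2' ty1 (nbhs_singleton hK) /z0 row_mxKr.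
have sy1 : s y1 = y0 by rewrite /s u2y1 y1E !row_mxKl !row_mxKr row_mxKl hsubmxK.
pose s' (y : 'rV[R]_(n1 + n2 + (m1 + m2))) := e (row_mx (lsubmx y) (Phiu2' (t y))).
have sms' : smooth_near y1 s'.
  apply: (@smooth_near_comp _ _ _ _ _ _ e); last exact: sme.
  exact: smooth_near_row_mx.
have sy1' : s' y1 = y0 by rewrite /s' u2y1 y1E row_mxKl ez0.
have [B nB GB] : exists2 B : set 'rV[R]_(n1 + n2 + (m1 + m2)), nbhs y0 B
    & forall a b, B a -> B b -> lsubmx (a - b) = 0 /\ rsubmx (rsubmx (a - b)) = 0 ->
      G a = G b.
  apply: (@near_eq_of_derive0 _ _ _ y0 G
    (fun w => lsubmx w = 0 /\ rsubmx (rsubmx w) = 0)).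
  apply: filterS2 (smooth_near_differentiable smG) kerG => y dGy kGy; split=> // w [w0 w1].
  exact/kGy.
have Bs := smooth_near_near sms sy1 nB; have Bs' := smooth_near_near sms' sy1' nB.
near=> y => k.
have x'Ky : Phix (Phix' (lsubmx y)) = lsubmx y by near: y.
have hKy : Psi (h (t y)) = t y by near: y.
have hEy : h (t y) = row_mx (lsubmx (t y)) (Phiu2' (t y)) by near: y.
have Bsy : B (s y) by near: y.
have Bsy' : B (s' y) by near: y.
have -> : subsys2 f Phix Phix' (refine_u2_inv Phix Phiu' Phiu2') y = G (s y).
  by rewrite /G /subsys2 /xu_coord_inv /refine_u2_inv /s !row_mxKl !row_mxKr x'Ky.
have -> : G (s y) = G (s' y).
  apply: GB => //; rewrite /s /s' /e row_mxKl row_mxKr opp_row_mx add_row_mx.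
  by rewrite row_mxKl row_mxKr subrr opp_row_mx add_row_mx row_mxKr subrr.
have -> : G (s' y) 0 (i2 k) = Phiu2 (row_mx (lsubmx y) (Phiu2' (t y))) 0 k.
  by rewrite [RHS]mxE.
have := congr1 rsubmx hKy; rewrite hEy /Psi row_mxKr /t !row_mxKl row_mxKr => ->.
by [].
Unshelve. all: by end_near. Qed.

Unset Implicit Arguments.

Theorem proposition12 (R : realType) (n m : nat)
    (f : 'rV[R]_(n + m) -> 'rV[R]_n) (x0 : 'rV[R]_n) (u0 : 'rV[R]_m)
    (f_smooth : smooth_near (row_mx x0 u0) f)
    (equilibrium : f (row_mx x0 u0) = x0)
    (rank_xu : \forall p \near row_mx x0 u0, \rank ('J f p) = n)
    (rank_u : \forall p \near row_mx x0 u0, \rank (dsubmx ('J f p)) = m)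
    (n1 n2 : nat) (n12 : (n1 + n2)%N = n)
    (Phix : 'rV[R]_n -> 'rV[R]_(n1 + n2)) (Phix' : 'rV[R]_(n1 + n2) -> 'rV[R]_n)
    (Phix_diffeo : local_diffeo x0 Phix Phix')
    (D0 : 'rV[R]_(n + m) -> {vspace 'rV[R]_(n + m)})
    (Delta1 P2 : 'rV[R]_n -> {vspace 'rV[R]_n})
    (D0P : is_D0 f (row_mx x0 u0) D0)
    (Delta1P : is_pushforward f (row_mx x0 u0) D0 Delta1)
    (P2P : is_P2 f (row_mx x0 u0) P2)
    (Delta1E : eq_distr_near x0 Delta1
       (span_at (fun k : 'I_n1 => coord_field Phix Phix' (lshift n2 k))))
    (P2E : eq_distr_near x0 P2 (span_at (fun k : 'I_n2 => diff_form Phix (rshift n1 k)))) :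
  (forall (m1 m2 : nat) (m12 : (m1 + m2)%N = m)
     (Phiu : 'rV[R]_(n + m) -> 'rV[R]_(m1 + m2))
     (Phiu' : 'rV[R]_(n + (m1 + m2)) -> 'rV[R]_m)
     (i2 : 'I_m2 -> 'I_n2),
     input_transf (row_mx x0 u0) Phiu Phiu' ->
     (\forall z \near row_mx (Phix x0) u0,
        \rank (dsubmx ('J (subsys2 f Phix Phix' rsubmx) z)) = m2) ->
     injective i2 ->
     simplified f (row_mx x0 u0) Phix Phix' Phiu Phiu' i2 ->
     eq_distr_near (row_mx x0 u0) D0 (span_du1 Phix Phix' Phiu Phiu'))
  /\
  (forall (m1 m2 : nat) (m12 : (m1 + m2)%N = m)
     (Phiu : 'rV[R]_(n + m) -> 'rV[R]_(m1 + m2))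
     (Phiu' : 'rV[R]_(n + (m1 + m2)) -> 'rV[R]_m),
     input_transf (row_mx x0 u0) Phiu Phiu' ->
     eq_distr_near (row_mx x0 u0) D0 (span_du1 Phix Phix' Phiu Phiu') ->
     exists (Phiu2 : 'rV[R]_(n1 + n2 + m2) -> 'rV[R]_m2)
            (Phiu2' : 'rV[R]_(n1 + n2 + m2) -> 'rV[R]_m2)
            (i2 : 'I_m2 -> 'I_n2),
       [/\ input_transf (row_mx (Phix x0) (rsubmx (Phiu (row_mx x0 u0))))
             Phiu2 Phiu2',
           injective i2
         & simplified f (row_mx x0 u0) Phix Phix'
             (refine_u2 Phix Phiu Phiu2) (refine_u2_inv Phix Phiu' Phiu2') i2]).
Proof.
have lp : lsubmx (row_mx x0 u0) = x0 by rewrite row_mxKl.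
have ldx : local_diffeo (lsubmx (row_mx x0 u0)) Phix Phix' by rewrite lp.
(* At the equilibrium the image point is [x0] itself, so the same local diffeomorphism serves for x
   and for x^+. *)
have smx : smooth_near (f (row_mx x0 u0)) Phix.
  by rewrite equilibrium; case: Phix_diffeo.
have D0w : \forall q \near row_mx x0 u0, forall w, w \in D0 q <->
    lsubmx w = 0 /\ 'D_w (fun z => rsubmx (Phix (f z))) q = 0.
  have [_ D0E _] := D0P.
  apply: (mem_D0 f_smooth _ rank_u D0E Delta1P); rewrite equilibrium.
  - exact: Phix_diffeo.
  - exact: Delta1E.
split=> [m1 m2 m12 Phiu Phiu' i2 ldu rk _ simp|m1 m2 _ Phiu Phiu' ldu D0E].
  apply: (D0_of_simplified m12 f_smooth smx ldx D0w ldu _ simp).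
  by rewrite /xu_coord lp row_mxKr.
have := simplified_of_D0 f_smooth smx ldx D0w ldu D0E.
by rewrite lp.
Qed.
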